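(* Let $X\subset\mathbb{C}$ be an unshielded compactum. Then $X$ has a finest finitely Suslinian monotone model $m_X:X\to X_{FS}$. That is, there exist a finitely Suslinian compactum $X_{FS}$ and a monotone map $m_X$ of $X$ onto $X_{FS}$ such that for every monotone map $\varphi$ of $X$ onto a finitely Suslinian compactum $Z$ there is a continuous map $g:X_{FS}\to Z$ with $\varphi=g\circ m_X$.
   Context: A compactum is a non-empty compact metric space (quotient spaces are considered up to homeomorphism); a continuum is a connected compactum. A compactum $X\subset\mathbb{C}$ is unshielded if it coincides with the boundary of the unbounded component $U_\infty(X)$ of $\mathbb{C}\setminus X$. A compactum is finitely Suslinian if, for every $\varepsilon>0$, every collection of pairwise disjoint subcontinua with diameters at least $\varepsilon$ is finite. All maps are continuous. A map $m:X\to Y$ onto $Y$ is monotone if the $m$-preimage of every continuum in $Y$ is a continuum. *)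

(* Defs.v *)
From HB Require Import structures.
From mathcomp Require Import all_boot all_order all_algebra.
From mathcomp Require Import complex.
From mathcomp Require Import all_classical all_reals all_analysis.

Set Implicit Arguments.
Unset Strict Implicit.
Unset Printing Implicit Defensive.

Import Order.TTheory GRing.Theory Num.Theory.
Import numFieldNormedType.Exports.

Local Open Scope classical_set_scope.
Local Open Scope complex_scope.
Local Open Scope ring_scope.

(* Compacta are subsets of an ambient space, which is a metric space at each
   use below; a compactum that is a whole space T is [set: T].  The library's
   compact and connected both hold of set0, hence the non-emptiness clause. *)
Definition compactum (T : topologicalType) (K : set T) : Prop :=
  K !=set0 /\ compact K.

Definition continuum (T : topologicalType) (K : set T) : Prop :=
  compactum K /\ connected K.

Definition boundary (T : topologicalType) (A : set T) : set T :=
  closure A `\` A°.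

(* The plane is R[i]^o: the library puts its topology and norm on the regular
   module of a numFieldType, with norms taking values in R[i]. *)
Definition unbounded_component (R : realType) (X U : set R[i]^o) : Prop :=
  (exists2 z, (~` X) z & U = connected_component (~` X) z) /\ ~ bounded_set U.

Definition unshielded (R : realType) (X : set R[i]^o) : Prop :=
  exists2 U, unbounded_component X U & X = boundary U.

(* Only meaningful for non-empty bounded A, since sup is 0 on sets without a
   supremum. *)
Definition diam (R : realType) (T : metricType R) (A : set T) : R :=
  sup [set d | exists x y, [/\ A x, A y & d = mdist x y]].

Definition finitely_suslinian (R : realType) (T : metricType R) (K : set T) :
    Prop :=
  forall (e : R) (F : set (set T)), 0 < e ->
    (forall C, F C -> [/\ C `<=` K, continuum C & e <= diam C]) ->
    (forall C D, F C -> F D -> C <> D -> C `&` D = set0) ->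
    finite_set F.

(* f is a total function of which only the restriction to A matters:
   {within A, continuous f} is continuity for the subspace topology of A. *)
Definition monotone_map_onto (S T : topologicalType) (A : set S) (B : set T)
    (f : S -> T) : Prop :=
  [/\ {within A, continuous f}, f @` A = B &
      forall C, C `<=` B -> continuum C -> continuum (A `&` f @^-1` C)].

(* Main.v *)
Require Import Defs.
From HB Require Import structures.
From mathcomp Require Import all_boot all_order all_algebra.
From mathcomp Require Import complex.
From mathcomp Require Import all_classical all_reals all_analysis.
From mathcomp Require Import zify lra.

(**
  Call two points of X limit-related if they lie on a limit of pairwise disjoint
  subcontinua of X, and let X_FS be the quotient of X by the smallest closed
  equivalence relation containing this relation.  Its classes are connected,
  since "to lie in the same component of a class" is again such a relation; so
  the quotient map is monotone.  The preimages of infinitely many disjoint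
  continua of X_FS of diameter at least e would accumulate on limit-related
  points with distinct images, so X_FS is finitely Suslinian.

  Let phi be a monotone map onto a finitely Suslinian Z, and suppose that it
  separates two limit-related points.  The images of the continua K_n involved
  cross three disjoint annuli of Z; as Z is finitely Suslinian, there are n and m
  such that phi(K_n) and phi(K_m) meet inside each of the three annuli.  So
  three disjoint fibres of phi join the disjoint continua K_n and K_m.  In the
  plane, one arm of this theta shape is enclosed by the other two and cannot lie
  on the boundary of the unbounded complementary domain.  The latter is proved
  on a fine square grid: for three lattice paths with common ends and with
  points q_i on them, the winding numbers modulo 2 of the loop (j, k) around q_i
  add up to 1.
*)

Set Implicit Arguments.
Unset Strict Implicit.
Unset Printing Implicit Defensive.

Import Order.TTheory GRing.Theory Num.Theory.
Import numFieldNormedType.Exports.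

Local Open Scope ring_scope.

(** * Crossing parities of lattice paths *)

(** On a fine grid connectedness becomes the existence of lattice paths, and enclosure becomes a
    parity that changes only across edges of the loop. The contradiction is numerical: each q_i is
    close to a point of X, hence to a point of the unbounded domain, around which no lattice loop
    near X winds oddly once the mesh is small; so three zeros would add up to 1. Two fibres would
    not do: a circle consists of two disjoint arcs joined by two others. Limits are taken along a
    free ultrafilter on the natural numbers. In a compact space every sequence of points then
    converges without passing to subsequences, and statements about almost all n and almost all m
    can be intersected, so that a single pair n, m serves all three annuli. *)

Definition grid_adj : rel (int * int) := fun v w =>
  ((v.1 == w.1) && (`|v.2 - w.2| == 1)) || ((v.2 == w.2) && (`|v.1 - w.1| ==
    1)).

(* A lattice point [f] also stands for the unit square with lower left corner
   [f]; crossings are with the horizontal ray leaving the centre of that square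
   to the right, and they are counted modulo 2. *)
Definition step_cross (f v w : int * int) : bool :=
  [&& v.1 == w.1, f.1 < v.1, v.2 != w.2 & Order.min v.2 w.2 == f.2].

Fixpoint path_cross (f x : int * int) (p : seq (int * int)) : bool :=
  if p is y :: p' then step_cross f x y (+) path_cross f y p' else false.

Lemma grid_adj_sym : symmetric grid_adj.
Proof. by move=> [v1 v2] [w1 w2];
  rewrite /grid_adj /= (eq_sym v1) (eq_sym v2) distrC (distrC v1). Qed.

(** A parity again: traversals of the edge in either direction are added modulo 2. *)
Fixpoint path_edge (u u' x : int * int) (p : seq (int * int)) : bool :=
  if p is y :: p' then
    (((x == u) && (y == u')) || ((x == u') && (y == u))) (+) path_edge u u' y p'
  else false.

Lemma path_edge_notin u u' x p : (u \notin x :: p) || (u' \notin x :: p) ->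
  path_edge u u' x p = false.
Proof.
elim: p x => //= y p IH x h; rewrite IH ?addbF.
  by move: h; rewrite !inE !negb_or !(eq_sym _ x) !(eq_sym _ y);
    case/orP=> /and3P[/negPf-> /negPf-> _]; rewrite ?andbF.
by case/orP: h; rewrite !inE !negb_or => /and3P[_ -> ->]; rewrite ?orbT.
Qed.

(** The two rays lie on one line, and the only edge met by the longer one alone is the edge shared
    by the two squares. *)
Lemma path_cross_left (c d : int) x p : path grid_adj x p ->
  path_cross (c - 1, d) x p (+) path_cross (c, d) x p =
  path_edge (c, d) (c, d + 1) x p.
Proof.
elim: p x => //= y p IH x /andP[xy /IH <-].
rewrite addbACA; congr (_ (+) _).
case: x y xy => [x1 x2] [y1 y2]; rewrite /grid_adj /step_cross /= !xpair_eqE.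
by lia.
Qed.

Lemma grid_adjP v w : grid_adj v w ->
  [\/ w = (v.1 + 1, v.2), w = (v.1, v.2 + 1), v = (w.1 + 1, w.2) |
      v = (w.1, w.2 + 1)].
Proof.
case: v w => [v1 v2] [w1 w2]; rewrite /grid_adj /= => h.
have : (w1 = v1 + 1 /\ w2 = v2) \/ (w1 = v1 /\ w2 = v2 + 1) \/
  (v1 = w1 + 1 /\ v2 = w2) \/ (v1 = w1 /\ v2 = w2 + 1) by lia.
case=> [[-> ->]|[[-> ->]|[[-> ->]|[-> ->]]]];
  by [constructor 1|constructor 2|constructor 3|constructor 4].
Qed.

(** Between the two rays lie the lattice points of row [d] to the right of [c]. A step that enters
    or leaves this half-row either crosses one of the rays or is the edge shared by the two squares;
    modulo 2 the entries and exits telescope to the end points. *)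
Lemma path_cross_down (c d : int) x p : path grid_adj x p ->
  path_cross (c, d - 1) x p (+) path_cross (c, d) x p =
  [&& x.2 == d & c < x.1] (+) [&& (last x p).2 == d & c < (last x p).1]
  (+) path_edge (c, d) (c + 1, d) x p.
Proof.
elim: p x => [|y p IH] x /=; first by rewrite addbb.
case/andP=> xy /IH IHp; rewrite addbACA IHp.
have -> : step_cross (c, d - 1) x y (+) step_cross (c, d) x y =
    [&& x.2 == d & c < x.1] (+) [&& y.2 == d & c < y.1] (+)
    ((x == (c, d)) && (y == (c + 1, d)) || (x == (c + 1, d)) && (y == (c, d))).
  case: x y xy {IHp} => [x1 x2] [y1 y2].
  by case/grid_adjP=> -[-> ->] /=; rewrite /step_cross /= !xpair_eqE; lia.
move: (_ && _) (_ && _) (_ && _) (_ || _) (path_edge _ _ _ _).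
by do 5!case.
Qed.

(** To the right of the square the ray acts as a full line, and each crossing switches between its
    two sides. *)
Lemma path_cross_right_of (f x : int * int) p : path grid_adj x p ->
  {in x :: p, forall v, f.1 < v.1} ->
  path_cross f x p = (f.2 < x.2) (+) (f.2 < (last x p).2).
Proof.
elim: p x => [|y p IH] x /=; first by rewrite addbb.
case/andP=> xy py h; rewrite IH //; last first.
  by move=> v vp; apply: h; rewrite inE vp orbT.
rewrite addbA; congr (_ (+) _).
have := h x (mem_head _ _); have := h y; rewrite !inE eqxx orbT => /(_ isT).
case: f x y xy {IH h py} => [f1 f2] [x1 x2] [y1 y2].
by case/grid_adjP=> -[-> ->]; rewrite /step_cross /=; lia.
Qed.

Lemma path_cross_outside (f x : int * int) p : path grid_adj x p ->
  {in x :: p, forall v, v.1 <= f.1} \/ {in x :: p, forall v, v.2 <= f.2} \/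
  {in x :: p, forall v, f.2 < v.2} ->
  path_cross f x p = false.
Proof.
elim: p x => [|y p IH] x //= /andP[xy py] h; rewrite IH //; last first.
  by case: h => [h|[h|h]]; [left|right; left|right; right] => v vp;
    apply: h; rewrite inE vp orbT.
rewrite addbF.
have : (x.1 <= f.1 /\ y.1 <= f.1) \/ (x.2 <= f.2 /\ y.2 <= f.2) \/
    (f.2 < x.2 /\ f.2 < y.2).
  by case: h => [h|[h|h]]; [left|right; left|right; right]; split;
    apply: h; rewrite !inE eqxx ?orbT.
case: f x y xy {IH h py} => [f1 f2] [x1 x2] [y1 y2].
by case/grid_adjP=> -[-> ->]; rewrite /step_cross /=; lia.
Qed.

(** The loop runs along [p] and back along [p']. Both paths start at [x]; direction does not matter
    modulo 2, so neither has to be reversed. *)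
Definition loop_cross f x p p' := path_cross f x p (+) path_cross f x p'.

Definition grid_loop x p p' :=
  [&& path grid_adj x p, path grid_adj x p' & last x p == last x p'].

Lemma loop_cross_left c d x p p' : grid_loop x p p' ->
  loop_cross (c - 1, d) x p p' (+) loop_cross (c, d) x p p' =
  path_edge (c, d) (c, d + 1) x p (+) path_edge (c, d) (c, d + 1) x p'.
Proof. by case/and3P=> h h' _; rewrite addbACA !path_cross_left. Qed.

Lemma loop_cross_down c d x p p' : grid_loop x p p' ->
  loop_cross (c, d - 1) x p p' (+) loop_cross (c, d) x p p' =
  path_edge (c, d) (c + 1, d) x p (+) path_edge (c, d) (c + 1, d) x p'.
Proof.
case/and3P=> h h' /eqP e; rewrite addbACA !path_cross_down // e.
by rewrite addbACA addbb.
Qed.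

Lemma loop_cross_outside (f x : int * int) p p' : grid_loop x p p' ->
  {in x :: p ++ p', forall v, v.1 <= f.1} \/
  {in x :: p ++ p', forall v, f.1 < v.1} \/
  {in x :: p ++ p', forall v, v.2 <= f.2} \/
  {in x :: p ++ p', forall v, f.2 < v.2} ->
  loop_cross f x p p' = false.
Proof.
case/and3P=> xp xp' /eqP e h; rewrite /loop_cross.
have s : {subset x :: p <= x :: p ++ p'} /\ {subset x :: p' <= x :: p ++ p'}.
  by split=> v; rewrite !inE mem_cat => /orP[->|->]; rewrite ?orbT.
case: s => s s'; case: h => [h|[h|h]].
- rewrite path_cross_outside //; last by left=> v /s; apply: h.
  by rewrite path_cross_outside //; left=> v /s'; apply: h.
- rewrite !path_cross_right_of //; first by rewrite e addbb.
    by move=> v /s'; apply: h.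
  by move=> v /s; apply: h.
- case: h => h.
    rewrite path_cross_outside //; last by right; left=> v /s; apply: h.
    by rewrite path_cross_outside //; right; left=> v /s'; apply: h.
  rewrite path_cross_outside //; last by right; right=> v /s; apply: h.
  by rewrite path_cross_outside //; right; right=> v /s'; apply: h.
Qed.

Lemma addb_eq_of a b : a (+) b = false -> a = b.
Proof. by case: a; case: b. Qed.

(** The edge between the square of [r] and the next square [r'], to the right or above, has the
    vertex [r'] as an end. So a loop that avoids this vertex does not separate the two squares. *)
Lemma loop_cross_adj x p p' q q' : grid_loop x p p' -> grid_adj q q' ->
  q \notin x :: p ++ p' -> q' \notin x :: p ++ p' ->
  loop_cross q x p p' = loop_cross q' x p p'.
Proof.
move=> lp.
suff main r r' : r' \notin x :: p ++ p' ->
    r' = (r.1 + 1, r.2) \/ r' = (r.1, r.2 + 1) ->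
    loop_cross r x p p' = loop_cross r' x p p'.
  move=> /grid_adjP[] e nq nq';
    [apply: main|apply: main|apply/esym/main|apply/esym/main];
    by [|left|right].
move=> nr'; have ne u : path_edge r' u x p (+) path_edge r' u x p' = false.
  move: nr'; rewrite !inE mem_cat !negb_or => /and3P[n1 n2 n3].
  by rewrite !path_edge_notin // !inE !negb_or ?n1 ?n2 ?n3.
case: r r' nr' ne => [r1 r2] [s1 s2] nr' ne /= [] [E1 E2]; subst;
  apply: addb_eq_of.
  by have := loop_cross_left (r1 + 1) r2 lp; rewrite addrK ne.
by have := loop_cross_down r1 (r2 + 1) lp; rewrite addrK ne.
Qed.

Lemma loop_cross_path x p p' q s : grid_loop x p p' -> path grid_adj q s ->
  {in q :: s, forall v, v \notin x :: p ++ p'} ->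
  loop_cross q x p p' = loop_cross (last q s) x p p'.
Proof.
move=> lp; elim: s q => //= y s IH q /andP[qy ys] h.
rewrite -IH //; last by move=> v vs; apply: h; rewrite inE vs orbT.
by apply: loop_cross_adj => //; apply: h; rewrite !inE eqxx ?orbT.
Qed.

Lemma path_edge_head a u b s : a \notin b :: s ->
  path_edge a u a (b :: s) = (b == u).
Proof.
move=> n; rewrite /= path_edge_notin ?n // addbF eqxx /=.
by case: eqP => //= _; move: n; rewrite inE negb_or => /andP[/negPf];
  rewrite eq_sym => ->; rewrite andbF.
Qed.

(** Going right or up from [a], the edge between the squares ends at [b], which is off the loop.
    Going left or down, it starts at [a], and as the arms do not return to [a], it is used exactly
    when it is the first step of an arm. *)
Lemma loop_cross_local a b h s h' s' :
  grid_loop a (h :: s) (h' :: s') -> a \notin h :: s -> a \notin h' :: s' ->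
  grid_adj a b -> b \notin a :: (h :: s) ++ (h' :: s') ->
  loop_cross b a (h :: s) (h' :: s') = loop_cross a a (h :: s) (h' :: s') (+)
   (if b == (a.1 - 1, a.2) then (h == (a.1, a.2 + 1)) (+) (h' == (a.1, a.2 + 1))
    else if b == (a.1, a.2 - 1) then (h == (a.1 + 1,
      a.2)) (+) (h' == (a.1 + 1, a.2))
    else false).
Proof.
case: a b => [a1 a2] [b1 b2] lp n n' ab nb.
have ne u : path_edge (b1, b2) u (a1, a2) (h :: s) (+) path_edge (b1,
  b2) u (a1, a2) (h' :: s') = false.
  move: nb; rewrite in_cons negb_or mem_cat negb_or => /and3P[n1 n2 n3].
  have e t : (b1, b2) \notin t -> (b1, b2) \notin (a1, a2) :: t.
    by rewrite in_cons negb_or n1.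
  by rewrite !path_edge_notin ?e.
have : [\/ (b1 = a1 /\ b2 = a2 + 1), (b1 = a1 + 1 /\ b2 = a2),
      (b1 = a1 - 1 /\ b2 = a2) | (b1 = a1 /\ b2 = a2 - 1)].
  by case/grid_adjP: ab => -[-> ->] /=; rewrite ?addrK;
    [constructor 2|constructor 1|constructor 3|constructor 4].
case=> -[? ?]; subst b1 b2.
- rewrite ifF; last by rewrite xpair_eqE /=; lia.
  rewrite ifF; last by rewrite xpair_eqE /=; lia.
  rewrite addbF; apply: addb_eq_of; rewrite addbC.
  by have := loop_cross_down a1 (a2 + 1) lp; rewrite addrK ne.
- rewrite ifF; last by rewrite xpair_eqE /=; lia.
  rewrite ifF; last by rewrite xpair_eqE /=; lia.
  rewrite addbF; apply: addb_eq_of; rewrite addbC.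
  by have := loop_cross_left (a1 + 1) a2 lp; rewrite addrK ne.
- rewrite !eqxx /=; have := loop_cross_left a1 a2 lp.
  by rewrite !path_edge_head // => <-; rewrite addbC addbK.
- rewrite ifF; last by rewrite xpair_eqE /=; lia.
  rewrite !eqxx /=; have := loop_cross_down a1 a2 lp.
  by rewrite !path_edge_head // => <-; rewrite addbC addbK.
Qed.

(** * Theta-shaped configurations on the lattice *)

(** The letters [n], [e], [x], [y] stand for a first step up, right, left, down, and [w] for the
    crossing parity of an arm around the centre. Each [w] occurs twice and cancels; three distinct
    directions out of four remain to be checked. *)
Lemma theta_parity (w1 w2 w3 n1 e1 x1 y1 n2 e2 x2 y2 n3 e3 x3 y3 : bool) :
  (n1 + e1 + x1 + y1 = 1)%N -> (n2 + e2 + x2 + y2 = 1)%N ->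
  (n3 + e3 + x3 + y3 = 1)%N ->
  ~~ (n1 && n2) -> ~~ (n1 && n3) -> ~~ (n2 && n3) ->
  ~~ (e1 && e2) -> ~~ (e1 && e3) -> ~~ (e2 && e3) ->
  ~~ (x1 && x2) -> ~~ (x1 && x3) -> ~~ (x2 && x3) ->
  ~~ (y1 && y2) -> ~~ (y1 && y3) -> ~~ (y2 && y3) ->
  w1 (+) w2 (+) (if x3 then n1 (+) n2 else if y3 then e1 (+) e2 else false)
  (+) (w2 (+) w3 (+) (if x1 then n2 (+) n3 else if y1 then e2 (+) e3 else
    false))
  (+) (w1 (+) w3 (+) (if x2 then n1 (+) n3 else if y2 then e1 (+) e3 else
    false)).
Proof.
move=> h1 h2 h3; case: n1 e1 x1 y1 h1 => [] [] [] [] // _;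
  case: n2 e2 x2 y2 h2 => [] [] [] [] // _ //=;
  case: n3 e3 x3 y3 h3 => [] [] [] [] // _ //=;
  by case: w1; case: w2; case: w3.
Qed.

(** Everything is decided at the common start: each parity around a neighbour of [a] is the parity
    around [a] plus a correction that depends on the first steps only. *)
Lemma theta_cross a b1 s1 b2 s2 b3 s3 :
  let t1 := b1 :: s1 in let t2 := b2 :: s2 in let t3 := b3 :: s3 in
  grid_loop a t1 t2 -> grid_loop a t2 t3 ->
  a \notin t1 -> a \notin t2 -> a \notin t3 ->
  b1 \notin t2 ++ t3 -> b2 \notin t1 ++ t3 -> b3 \notin t1 ++ t2 ->
  loop_cross b3 a t1 t2 (+) loop_cross b1 a t2 t3 (+) loop_cross b2 a t1 t3.
Proof.
move=> t1 t2 t3 l12 l23 a1 a2 a3 n1 n2 n3.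
have l13 : grid_loop a t1 t3.
  case/and3P: l12 => p1 _ e12; case/and3P: l23 => _ p3 e23.
  by rewrite /grid_loop p1 p3 (eqP e12) (eqP e23) eqxx.
have ab1 : grid_adj a b1 by case/and3P: l12 => /andP[].
have ab2 : grid_adj a b2 by case/and3P: l23 => /andP[].
have ab3 : grid_adj a b3 by case/and3P: l23 => _ /andP[].
have na b t : a \notin b :: t -> b != a.
  by rewrite in_cons negb_or eq_sym => /andP[].
have nb b t t' : b != a -> b \notin t ++ t' -> b \notin a :: t ++ t'.
  by rewrite [_ \in a :: _]in_cons negb_or => ->.
rewrite (loop_cross_local l12 a1 a2 ab3 (nb _ _ _ (na _ _ a3) n3)).
rewrite (loop_cross_local l23 a2 a3 ab1 (nb _ _ _ (na _ _ a1) n1)).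
rewrite (loop_cross_local l13 a1 a3 ab2 (nb _ _ _ (na _ _ a2) n2)).
have d12 : b1 != b2 by move: n1; rewrite mem_cat in_cons !negb_or =>
  /andP[/andP[]].
have d13 : b1 != b3 by move: n1;
  rewrite mem_cat [X in _ || X]in_cons !negb_or => /and3P[].
have d23 : b2 != b3 by move: n2;
  rewrite mem_cat [X in _ || X]in_cons !negb_or => /and3P[].
rewrite /loop_cross.
move: (path_cross a a t1) (path_cross a a t2) (path_cross a a t3) => w1 w2 w3.
have key b : grid_adj a b ->
    ((b == (a.1, (a.2 + 1)%R)) + (b == ((a.1 + 1)%R, a.2)) +
    (b == ((a.1 - 1)%R, a.2)) + (b == (a.1, (a.2 - 1)%R)) = 1)%N.
  move=> /grid_adjP; case: a b {w1 w2 w3 l12 l23 a1 a2 a3 l13 ab1 ab2 ab3 na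
    nb} => [x y] [u v].
  by rewrite !xpair_eqE /=; case=> -[]; lia.
have excl b b' u : b != b' -> ~~ ((b == u) && (b' == u)).
  by move=> bb'; apply/negP => /andP[/eqP e /eqP e']; move: bb';
    rewrite e e' eqxx.
apply: theta_parity; rewrite ?key //; exact: excl.
Qed.

(** The test points may move out along the initial parts [d1], [d2], [d3]. Only these must avoid the
    other arms; the remainders may overlap one another. *)
Lemma theta_arms a d1 e1 d2 e2 d3 e3 :
  let t1 := d1 ++ e1 in let t2 := d2 ++ e2 in let t3 := d3 ++ e3 in
  grid_loop a t1 t2 -> grid_loop a t2 t3 -> grid_loop a t1 t3 ->
  d1 != [::] -> d2 != [::] -> d3 != [::] ->
  a \notin t1 -> a \notin t2 -> a \notin t3 ->
  {in d1, forall v, v \notin t2 ++ t3} ->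
  {in d2, forall v, v \notin t1 ++ t3} ->
  {in d3, forall v, v \notin t1 ++ t2} ->
  loop_cross (last a d3) a t1 t2 (+) loop_cross (last a d1) a t2 t3 (+)
  loop_cross (last a d2) a t1 t3.
Proof.
case: d1 d2 d3 => [//|b1 d1] [//|b2 d2] [//|b3 d3] t1 t2 t3.
move=> l12 l23 l13 _ _ _ a1 a2 a3 n1 n2 n3.
have arm b d e t t' : grid_loop a t t' -> path grid_adj a ((b :: d) ++ e) ->
    a \notin (b :: d) ++ e -> {in b :: d, forall v, v \notin t ++ t'} ->
    loop_cross (last a (b :: d)) a t t' = loop_cross b a t t'.
  move=> l /=; rewrite cat_path => /and3P[_ bd _] na nd.
  apply/esym/loop_cross_path => // v vd; rewrite inE negb_or nd // andbT.
  by apply: contraNneq na => <-; rewrite -cat_cons mem_cat vd.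
have p1 : path grid_adj a t1 by case/and3P: l12.
have p2 : path grid_adj a t2 by case/and3P: l12.
have p3 : path grid_adj a t3 by case/and3P: l23.
rewrite (arm _ _ _ _ _ l12 p3) // (arm _ _ _ _ _ l23 p1) // (arm _ _ _ _ _ l13
  p2) //.
by apply: theta_cross => //; [apply: n1|apply: n2|apply: n3]; exact: mem_head.
Qed.

Definition linked (T : eqType) (e : rel T) (A : pred T) :=
  forall v w, v \in A -> w \in A ->
    exists p, [/\ path e v p, last v p = w & all A p].

(* The centre of the tripod is where a path from [f3] first meets a simple path
   joining [f1] to [f2]. *)
Lemma tripod (T : eqType) (e : rel T) (A : pred T) f1 f2 f3 g1 g2 g3 :
  symmetric e -> linked e A ->
  f1 \in A -> f2 \in A -> f3 \in A -> e f1 g1 -> e f2 g2 -> e f3 g3 ->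
  exists a l1 l2 l3, [/\ a \in A,
    [/\ path e a (rcons l1 g1), path e a (rcons l2 g2) &
      path e a (rcons l3 g3)],
    [/\ all A l1, all A l2 & all A l3],
    [/\ a \notin l1, a \notin l2 & a \notin l3] &
    [/\ {in l1, forall v, v \notin l2}, {in l1, forall v, v \notin l3} &
        {in l2, forall v, v \notin l3}]].
Proof.
move=> es conn f1A f2A f3A e1 e2 e3.
have [s0 [s0p s0l s0A]] := conn _ _ f1A f2A.
have [s [sp sl su sA]] : exists s,
    [/\ path e f1 s, last f1 s = f2, uniq (f1 :: s) & all A (f1 :: s)].
  case/shortenP: s0p s0l => s sp su ss sl; exists s; split=> //=.
  by rewrite -topredE /= in f1A; rewrite f1A; apply/allP => v /ss;
    move/allP: s0A; apply.
have [r [rp rl rA]] := conn _ _ f3A f1A.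
have hs : has (mem (f1 :: s)) (f3 :: r).
  by apply/hasP; exists f1; [rewrite -rl mem_last | rewrite /= inE eqxx].
have A3 : all A (f3 :: r) by rewrite /= rA andbT.
have p3 : path e g3 (f3 :: r) by rewrite /= es e3.
move: (f3 :: r) hs A3 p3 => R hs; case: (split_find hs) => a r1 r2 /= as_ r1s.
rewrite all_cat all_rcons cat_path => /andP[/andP[aA r1A] _] /andP[r1p _].
have ps : path e g1 (f1 :: s) by rewrite /= es e1.
have ls : last g1 (f1 :: s) = f2 by [].
move: (f1 :: s) as_ su sA ps ls r1s => S as_.
case/splitPr: as_ => s1 s2 su; rewrite all_cat /= => /and3P[s1A _ s2A].
rewrite -cat_rcons cat_path last_rcons => /andP[s1p s2p].
rewrite last_cat last_rcons => ls r1s.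
have r1n v : v \in r1 -> v \notin rcons s1 a ++ s2 by move/(hasPn r1s).
exists a, (rev s1), s2, (rev r1); split => //.
- split.
  + have := rev_path e g1 (rcons s1 a).
    rewrite last_rcons belast_rcons rev_cons => ->.
    by rewrite (eq_path (e' := e)) // => x y; rewrite es.
  + by rewrite rcons_path s2p ls.
  + have := rev_path e g3 (rcons r1 a).
    rewrite last_rcons belast_rcons rev_cons => ->.
    by rewrite (eq_path (e' := e)) // => x y; rewrite es.
- by rewrite !all_rev.
- move: su; rewrite cat_uniq /= => /and4P[_ /norP[as1 _] as2 _].
  rewrite !mem_rev; split => //.
  by apply/negP => /r1n; rewrite mem_cat mem_rcons mem_head.
- have ss v : v \in s1 -> v \notin s2.
    move=> vs1; apply/negP => vs2; move: su; rewrite cat_uniq /=.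
    by case/and3P=> _ /norP[_ /hasPn/(_ _ vs2)]; rewrite /= vs1.
  split=> v; rewrite ?mem_rev; first exact: ss.
    by move=> vs; apply/negP => /r1n; rewrite mem_cat mem_rcons inE vs !orbT.
  by move=> vs; apply/negP => /r1n; rewrite mem_cat vs orbT.
Qed.

Lemma last_hit (T : eqType) (A : pred T) u p : u \in A ->
  exists p0 f s, [/\ u :: p = p0 ++ f :: s, f \in A & all (predC A) s].
Proof.
move=> uA; elim/last_ind: p => [|p x [p0 [f [s [e fA sA]]]]].
  by exists [::], u, [::].
have [xA|xA] := boolP (x \in A); first by exists (u :: p), x, [::];
  rewrite cats1.
exists p0, f, (rcons s x); split=> //; first by rewrite -rcons_cons e rcons_cat.
by rewrite all_rcons sA andbT.
Qed.

(** A path in [F] is stopped at its first vertex in [B] and started at its last earlier vertex in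
    [A]. The test point [q] is its first vertex outside [N]; it precedes [B] because no vertex of
    [N] is adjacent to [B]. *)
Lemma arm (T : eqType) (e : rel T) (A B F N : pred T) u w :
  linked e F -> u \in F -> u \in A -> w \in F -> w \in B ->
  {in A, forall v, v \notin B} -> {subset A <= N} ->
    {in B, forall v, v \notin N} ->
  (forall v v', v \in N -> v' \in B -> ~~ e v v') ->
  exists f s q r, [/\ f \in A, path e f (s ++ q :: r),
    {in s ++ q :: r, forall v, [&& v \in F & v \notin A]} /\
    {in rcons s q, forall v, v \notin B},
    last q r \in B & q \notin N /\ (exists2 y, y \in N & e y q)].
Proof.
move=> lF uF uA wF wB AB AN BN NB.
have [p [pp pl pF]] := lF _ _ uF wF.
have hB : has (mem B) p.
  case: p pp pl pF => [|x p] _.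
    by move=> /= uw; move: (AB _ uA); rewrite uw wB.
  by move=> xw _; apply/hasP; exists w => //; rewrite -xw;
    exact: (mem_last x p).
have : all F p by [].
case: (split_find hB) pp pF => b p1 p2 /= bB p1B; rewrite cat_path =>
  /andP[p1p _].
move=> _; rewrite all_cat all_rcons => /andP[/andP[bF p1F] _].
have [p0 [f [s [es fA sA]]]] := last_hit p1 uA.
have fs : path e f (rcons s b).
  case: p0 es => [[<- <-] //|_ p0 [_ e1]].
  by move: p1p; rewrite e1 rcons_cat cat_path /= => /and3P[].
have sub : {subset s <= p1}.
  by case: p0 es => [[_ ->] //|_ p0 [_ ->]] v vs; rewrite mem_cat inE vs !orbT.
have bA : b \notin A by apply/negP => /AB; rewrite bB.
have hN : has (predC (mem N)) (rcons s b).
  by apply/hasP; exists b; rewrite ?mem_rcons ?mem_head //=; apply: BN.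
have sb v : v \in rcons s b -> v \notin B -> v \in s.
  by rewrite mem_rcons inE => /orP[/eqP->|//]; rewrite bB.
have sF v : v \in rcons s b -> (v \in F) && (v \notin A).
  rewrite mem_rcons inE => /orP[/eqP->|vs]; first by rewrite [b \in F]bF bA.
  by apply/andP; split; [apply: (allP p1F); apply: sub|exact: (allP sA _ vs)].
have rl : last f (rcons s b) = b by rewrite last_rcons.
move: (rcons s b) hN fs sb sF rl => S hN.
case: (split_find hN) => q s1 s2 /= qN s1N; rewrite cat_rcons => fs sb sF rl.
have s1N' : {subset s1 <= N}.
  by move=> v vs; move/hasPn: s1N => /(_ _ vs) /=; rewrite negbK.
have lN : last f s1 \in N.
  have : last f s1 \in f :: s1 by exact: mem_last.
  by rewrite inE => /orP[/eqP->|/s1N' //]; exact: AN.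
have eq : e (last f s1) q by move: fs; rewrite cat_path /= => /and3P[].
exists f, s1, q, s2; split=> //.
- split=> // v; rewrite mem_rcons inE => /orP[/eqP->|/s1N' vN].
    by apply/negP => /(NB _ _ lN); rewrite eq.
  by apply/negP => /BN; rewrite vN.
- by move: rl; rewrite last_cat /= => ->.
- by split=> //; exists (last f s1).
Qed.

(** The set [N] is a margin around [A]: a test point just outside [N] is away from [A] and, being
    next to [N], still away from [B]. Each arm is a leg of a tripod in [A], a crossing in its [F],
    and a tail in [B]. *)
Lemma theta_lattice (A B F1 F2 F3 N : pred (int * int)) u1 u2 u3 w1 w2 w3 :
  linked grid_adj A -> linked grid_adj B ->
  linked grid_adj F1 -> linked grid_adj F2 -> linked grid_adj F3 ->
  u1 \in F1 -> u1 \in A -> w1 \in F1 -> w1 \in B ->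
  u2 \in F2 -> u2 \in A -> w2 \in F2 -> w2 \in B ->
  u3 \in F3 -> u3 \in A -> w3 \in F3 -> w3 \in B ->
  {in A, forall v, v \notin B} ->
  {in F1, forall v, v \notin F2} -> {in F1, forall v, v \notin F3} ->
  {in F2, forall v, v \notin F3} ->
  {subset A <= N} -> {in B, forall v, v \notin N} ->
  (forall v v', v \in N -> v' \in B -> ~~ grid_adj v v') ->
  exists a t1 t2 t3 q1 q2 q3,
  [/\ [/\ grid_loop a t1 t2, grid_loop a t2 t3 & grid_loop a t1 t3],
    [/\ a \in A, all [predU predU A B & F1] t1, all [predU predU A B & F2] t2 &
      all [predU predU A B & F3] t3],
    [/\ q1 \in F1, q2 \in F2 & q3 \in F3],
    (forall q, q \in [:: q1; q2; q3] ->
      q \notin N /\ (exists2 y, y \in N & grid_adj y q)) &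
    loop_cross q3 a t1 t2 (+) loop_cross q1 a t2 t3 (+) loop_cross q2 a t1 t3].
Proof.
move=> lA lB l1 l2 l3 u1F u1A w1F w1B u2F u2A w2F w2B u3F u3A w3F w3B.
move=> AB F12 F13 F23 AN BN NB.
have [f1 [s1 [q1 [r1 [f1A p1 [in1 nB1] lB1 Q1]]]]] :=
  arm l1 u1F u1A w1F w1B AB AN BN NB.
have [f2 [s2 [q2 [r2 [f2A p2 [in2 nB2] lB2 Q2]]]]] :=
  arm l2 u2F u2A w2F w2B AB AN BN NB.
have [f3 [s3 [q3 [r3 [f3A p3 [in3 nB3] lB3 Q3]]]]] :=
  arm l3 u3F u3A w3F w3B AB AN BN NB.
have [b2 [b2p b2l b2B]] := lB _ _ lB2 lB1.
have [b3 [b3p b3l b3B]] := lB _ _ lB3 lB1.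
pose hd s q : int * int := head q s.
have ehd f s q r : path grid_adj f (s ++ q :: r) -> grid_adj f (hd s q).
  by case: s => [|x s] /= /andP[].
have [a [k1 [k2 [k3 [aA [kp1 kp2 kp3] [k1A k2A k3A] [ak1 ak2 ak3] [k12 k13
  k23]]]]]] :=
  tripod grid_adj_sym lA f1A f2A f3A (ehd _ _ _ _ p1) (ehd _ _ _ _ p2) (ehd _ _
    _ _ p3).
have full k f s q r b : path grid_adj f (s ++ q :: r) ->
  path grid_adj a (rcons k (hd s q)) ->
    path grid_adj (last q r) b ->
      path grid_adj a ((k ++ rcons s q) ++ (r ++ b)).
  move=> pf pk pb; rewrite cat_path cat_path; apply/andP; split.
    move: pf pk; rewrite rcons_path => pf /andP[-> ak] /=.
    case: s pf ak => [|x s] /=; first by move=> _ ->.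
    by rewrite cat_path rcons_path => /and3P[_ -> /andP[->]] _ ->.
  rewrite last_cat last_rcons cat_path pb andbT.
  by move: pf; rewrite cat_path /= => /and3P[].
(* The common end is the point where the first arm reaches [B], so only the other two arms continue
   inside [B]. *)
exists a, ((k1 ++ rcons s1 q1) ++ (r1 ++ [::])),
  ((k2 ++ rcons s2 q2) ++ (r2 ++ b2)),
  ((k3 ++ rcons s3 q3) ++ (r3 ++ b3)), q1, q2, q3.
have P1 := full _ _ _ _ _ [::] p1 kp1 isT.
have P2 := full _ _ _ _ _ _ p2 kp2 b2p.
have P3 := full _ _ _ _ _ _ p3 kp3 b3p.
have L k s q r b : last a ((k ++ rcons s q) ++ (r ++ b)) = last (last q r) b.
  by rewrite !last_cat last_rcons.
have G12 : grid_loop a ((k1 ++ rcons s1 q1) ++ (r1 ++ [::])) ((k2 ++ rcons s2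
  q2) ++ (r2 ++ b2)).
  by rewrite /grid_loop P1 P2 !L /= b2l eqxx.
have G23 : grid_loop a ((k2 ++ rcons s2 q2) ++ (r2 ++ b2)) ((k3 ++ rcons s3 q3)
  ++ (r3 ++ b3)).
  by rewrite /grid_loop P2 P3 !L /= b2l b3l eqxx.
have G13 : grid_loop a ((k1 ++ rcons s1 q1) ++ (r1 ++ [::])) ((k3 ++ rcons s3
  q3) ++ (r3 ++ b3)).
  by rewrite /grid_loop P1 P3 !L /= b3l eqxx.
have mem_all (k s : seq (int * int)) q r b v : v \in (k ++ rcons s q) ++ (r ++
  b) ->
    [\/ v \in k, v \in s ++ q :: r | v \in b].
  rewrite !mem_cat mem_rcons !inE.
  by case/orP=> [/orP[|/orP[]]|/orP[]] ->; rewrite ?orbT;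
    by [constructor 1|constructor 2|constructor 3].
have mem_pre (k s : seq (int * int)) q r v : v \in k ++ rcons s q ->
    v \in k \/ v \in s ++ q :: r /\ v \in rcons s q.
  rewrite !mem_cat mem_rcons !inE => /orP[->|]; first by left.
  by case/orP=> ->; right; rewrite ?orbT.
have nota k s q r b (F : pred (int * int)) : {in s ++ q :: r, forall v,
  (v \in F) && (v \notin A)} ->
    all B b -> a \notin k -> a \notin (k ++ rcons s q) ++ (r ++ b).
  move=> inF bB ak; apply/negP => /mem_all[]; first by apply/negP.
    by move/inF; rewrite aA andbF.
  by move/(allP bB) => h; move: (AB _ aA); rewrite [_ \in B]h.
have disj k s q r (F : pred (int * int)) k' s' q' r' b' (F' : pred (int * int))
  :
    {in s ++ q :: r, forall v, (v \in F) && (v \notin A)} -> 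
    {in rcons s q, forall v, v \notin B} -> all A k ->
    {in s' ++ q' :: r', forall v, (v \in F') && (v \notin A)} -> all A k' ->
    all B b' -> (forall v, v \in F -> v \in F' -> False) ->
    (forall v, v \in k -> v \in k' -> False) ->
    {in k ++ rcons s q, forall v, v \notin (k' ++ rcons s' q') ++ (r' ++ b')}.
  move=> inF nB kA inF' kA' bB' FF kk v /(mem_pre _ _ _ r) [vk|[vs vsq]];
    apply/negP => /mem_all[vk'|vs'|vb'].
  - exact: kk vk vk'.
  - by move/inF': vs'; rewrite [v \in A](allP kA _ vk) andbF.
  - by move: (AB _ (allP kA _ vk)); rewrite [v \in B](allP bB' _ vb').
  - by move/inF: vs; rewrite [v \in A](allP kA' _ vk') andbF.
  - by move/inF: vs => /andP[vF _]; move/inF': vs' => /andP[vF' _];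
    exact: FF vF vF'.
  - by move: (nB _ vsq); rewrite [v \in B](allP bB' _ vb').
have alls k s q r b (F : pred (int * int)) : {in s ++ q :: r, forall v,
  (v \in F) && (v \notin A)} ->
    all A k -> all B b -> all [predU predU A B &
      F] ((k ++ rcons s q) ++ (r ++ b)).
  move=> inF kA bB; apply/allP => v /mem_all[vk|/inF/andP[vF _]|vb].
  - by apply/orP; left; apply/orP; left; exact: (allP kA).
  - by apply/orP; right.
  - by apply/orP; left; apply/orP; right; exact: (allP bB).
have inQ s q r (F : pred (int * int)) : {in s ++ q :: r, forall v,
  (v \in F) && (v \notin A)} -> q \in F.
  by move/(_ q); rewrite mem_cat mem_head orbT => /(_ isT)/andP[].
split=> //.
- by split=> //; apply: alls.
- by split; [exact: inQ in1|exact: inQ in2|exact: inQ in3].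
- by move=> q; rewrite !inE => /orP[/eqP->|/orP[/eqP->|/eqP->]].
have la k s q : last a (k ++ rcons s q) = q by rewrite last_cat last_rcons.
have := @theta_arms a (k1 ++ rcons s1 q1) (r1 ++ [::]) (k2 ++ rcons s2 q2)
  (r2 ++ b2) (k3 ++ rcons s3 q3) (r3 ++ b3) G12 G23 G13.
rewrite !la; apply.
- by case: (k1) => //; case: (s1).
- by case: (k2) => //; case: (s2).
- by case: (k3) => //; case: (s3).
- exact: nota in1 _ _.
- exact: nota in2 _ _.
- exact: nota in3 _ _.
all: move=> v vd; rewrite mem_cat negb_or; apply/andP; split.
- exact: (disj _ _ _ _ _ _ _ _ _ _ _ in1 nB1 k1A in2 k2A b2B
    (fun x a b => negP (F12 x a) b)
    (fun x a b => negP (k12 x a) b) v vd).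
- exact: (disj _ _ _ _ _ _ _ _ _ _ _ in1 nB1 k1A in3 k3A b3B
    (fun x a b => negP (F13 x a) b)
    (fun x a b => negP (k13 x a) b) v vd).
- exact: (disj _ _ _ _ _ _ _ _ _ _ _ in2 nB2 k2A in1 k1A (isT : all B [::])
    (fun x a b => negP (F12 x b) a)
    (fun x a b => negP (k12 x b) a) v vd).
- exact: (disj _ _ _ _ _ _ _ _ _ _ _ in2 nB2 k2A in3 k3A b3B
    (fun x a b => negP (F23 x a) b)
    (fun x a b => negP (k23 x a) b) v vd).
- exact: (disj _ _ _ _ _ _ _ _ _ _ _ in3 nB3 k3A in1 k1A (isT : all B [::])
    (fun x a b => negP (F13 x b) a)
    (fun x a b => negP (k13 x b) a) v vd).
- exact: (disj _ _ _ _ _ _ _ _ _ _ _ in3 nB3 k3A in2 k2A b2B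
    (fun x a b => negP (F23 x b) a)
    (fun x a b => negP (k23 x b) a) v vd).
Qed.

Local Open Scope classical_set_scope.

(** * Chains in metric spaces *)

Lemma ball_trans (R : numDomainType) (T : pseudoMetricType R) (x y z : T) (a b
  c : R) :
  ball x a y -> ball y b z -> a + b <= c -> ball x c z.
Proof. by move=> xy yz abc; apply: le_ball abc _ (ball_triangle xy yz). Qed.

Lemma invS_small (R : archiRealFieldType) (d : R) : 0 < d ->
  exists n, forall k, (n <= k)%N -> k.+1%:R^-1 < d.
Proof.
move=> d0; exists (Num.truncn d^-1).+1 => k nk.
rewrite -[ltRHS]invrK ltf_pV2 ?posrE ?invr_gt0 //.
by apply: lt_le_trans (truncnS_gt _) _; rewrite ler_nat; apply: leq_trans nk _.
Qed.

Lemma uniform_gap (R : realFieldType) (T : pseudoMetricType R) (A B : set T) :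
  compact A -> closed B -> A `&` B = set0 ->
  exists2 e : R, 0 < e & forall a b, A a -> B b -> ~ ball a e b.
Proof.
move=> /compact_near_coveringP cA cB AB.
have := cA R (0^'+) (fun e a => forall b, B b -> ~ ball a e b) _.
case.
  move=> a Aa; have : nbhs a (~` B).
    apply: open_nbhs_nbhs; split; first exact/closed_openC.
    by move=> Ba; have : set0 a by rewrite -AB.
  rewrite -nbhs_ballE => -[r /= r0 rB].
  have r2 : 0 < r / 2 by rewrite divr_gt0.
  exists (ball a (r / 2), [set e | e < r / 2]) => /=.
    by split; [exact: nbhsx_ballx|exact: nbhs_right_lt].
  move=> [x e] /= [ax er] b Bb xb; apply: (rB b) => //.
  by apply: ball_trans ax xb _; lra.
move=> r /= r0 h; exists (r / 2); first by rewrite divr_gt0.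
by move=> a b Aa Bb; apply: h Bb => //=;
  [rewrite sub0r normrN gtr0_norm ?divr_gt0//; lra|rewrite divr_gt0].
Qed.

(** For symmetric balls this says that any two points of [C] are joined by an [e]-chain in [C],
    without mentioning finite sequences. *)
Definition fine_chained (R : numDomainType) (T : pseudoMetricType R) (e : R) (C
  : set T) :=
  forall P : set T, C `&` P !=set0 -> C `\` P !=set0 ->
    exists p q, [/\ C p, P p, C q, ~ P q & ball p e q].

Lemma connected_fine_chained (R : numDomainType) (T : pseudoMetricType R) (e :
  R) (C : set T) :
  0 < e -> connected C -> fine_chained e C.
Proof.
move=> e0 cC P [x [Cx Px]] [y [Cy nPy]]; apply: contrapT => nex.
have far p q : C p -> P p -> C q -> ~ P q -> ~ ball p e q.
  by move=> Cp Pp Cq nPq pq; apply: nex; exists p, q.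
suff CP : C `&` P = C by move: Cy; rewrite -CP => -[].
apply: cC; first by exists x.
- exists (\bigcup_(p in C `&` P) (ball p e)°);
  first by apply: bigcup_open => p _; exact: open_interior.
  apply/seteqP; split=> [p [Cp Pp]|q [Cq [p [Cp Pp] /interior_subset pq]]].
    by split=> //; exists p => //; exact: nbhsx_ballx.
  by split=> //; apply: contrapT => nPq; exact: far pq.
- exists (closure (C `&` P)); first exact: closed_closure.
  apply/seteqP; split=> [p Cp|q [Cq /(_ (ball q e))]].
    by split; [case: Cp|exact: subset_closure].
  case; first exact: nbhsx_ballx.
  move=> p [[Cp Pp] /ball_sym pq]; split=> //.
  by apply: contrapT => nPq; exact: far pq.
Qed.

(** * Discretization of plane continua *)

Section discretization.
Variable R : realType.
Implicit Types (x y : R * R) (h : R) (v w : int * int) (K L : set (R * R)).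

Definition cell h x : int * int := (Num.floor (x.1 / h), Num.floor (x.2 / h)).

Definition cell_near v w := (`|v.1 - w.1| <= 1) && (`|v.2 - w.2| <= 1).

Definition grid_point h v : R * R := (h * v.1%:~R, h * v.2%:~R).

(** The eight neighbours of each cell are included because close points may lie in cells that touch
    only at a corner; inside such a block of nine the corner can be bypassed by grid steps. *)
Definition mesh h K : pred (int * int) :=
  fun v => `[< exists2 x, K x & cell_near (cell h x) v >].

Lemma floor_near h (a : R) (m : int) : 0 < h -> `|Num.floor (a / h) - m| <= 1 ->
  `|a - h * m%:~R| < 3 * h.
Proof.
move=> h0 hm; have /andP[] := floor_itv (a / h).
set n := Num.floor _ in hm *.
rewrite ler_pdivlMr // ltr_pdivrMr // intrD.
have : (m - 1 <= n) /\ (n <= m + 1) by lia.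
rewrite -!(ler_int R) !intrD => -[]; set N : R := n%:~R; set M : R :=
  m%:~R => *.
by rewrite ltr_norml; nra.
Qed.

Lemma cell_near_ball h x v : 0 < h -> cell_near (cell h x) v ->
  ball x (3 * h) (grid_point h v).
Proof. by move=> h0 /andP[h1 h2]; split; exact: floor_near. Qed.

Lemma grid_adj_ball h v w : 0 < h -> grid_adj v w ->
  ball (grid_point h v) (2 * h) (grid_point h w).
Proof.
move=> h0 /grid_adjP vw.
have : (`|v.1 - w.1| <= 1) /\ (`|v.2 - w.2| <= 1).
  by case: v w vw => [v1 v2] [w1 w2] [] [] /=; lia.
have key (a b : int) : `|a - b| <= 1 -> `|h * a%:~R - h * b%:~R| < 2 * h.
  move=> ab; rewrite -mulrBr -intrB normrM gtr0_norm // mulrC ltr_pM2r //.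
  by rewrite -intr_norm (_ : 2 = 2%:~R) // ltr_int; lia.
by case=> h1 h2; split; exact: key.
Qed.

Lemma floor_ball h (a b : R) : 0 < h -> `|a - b| < h ->
  `|Num.floor (a / h) - Num.floor (b / h)| <= 1.
Proof.
move=> h0 ab.
have /andP[] := floor_itv (a / h); have /andP[] := floor_itv (b / h).
set n := Num.floor _; set m := Num.floor _.
rewrite !ler_pdivlMr // !ltr_pdivrMr // => h1 h2 h3 h4.
move: ab; rewrite ltr_norml => /andP[ab1 ab2].
have : n < m + 2.
  by rewrite -(ltr_int R) intrD; move: h1 h2 h3 h4; rewrite !intrD; nra.
have : m < n + 2.
  by rewrite -(ltr_int R) intrD; move: h1 h2 h3 h4; rewrite !intrD; nra.
by lia.
Qed.

Lemma ball_cell_near h x y : 0 < h -> ball x h y ->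
  cell_near (cell h x) (cell h y).
Proof. by move=> h0 [xy1 xy2]; apply/andP; split; exact: floor_ball. Qed.

Lemma cell_near_refl v : cell_near v v.
Proof. by rewrite /cell_near !subrr normr0. Qed.

Lemma mesh_cell h K x : K x -> cell h x \in mesh h K.
Proof. by move=> Kx; apply/asboolP; exists x => //; exact: cell_near_refl. Qed.

Lemma meshP h K v : 0 < h -> v \in mesh h K ->
  exists2 x, K x & ball x (3 * h) (grid_point h v).
Proof. by move=> h0 /asboolP[x Kx xv]; exists x => //;
  exact: cell_near_ball. Qed.

Lemma mesh_sub h K L : K `<=` L -> {subset mesh h K <= mesh h L}.
Proof. by move=> KL v /asboolP[x /KL Lx xv]; apply/asboolP; exists x. Qed.

Lemma mesh_disjoint h K L : 0 < h -> (forall x y, K x -> L y ->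
  ~ ball x (6 * h) y) ->
  {in mesh h K, forall v, v \notin mesh h L}.
Proof.
move=> h0 KL v /(meshP h0)[x Kx xv]; apply/negP => /(meshP h0)[y Ly yv].
by apply: (KL x y) => //; apply: ball_trans xv (ball_sym yv) _; lra.
Qed.

Lemma cell_near_path c v : cell_near c v ->
  exists p, [/\ path grid_adj c p, last c p = v & all (cell_near c) p].
Proof.
case: c v => [c1 c2] [v1 v2] /andP[/= h1 h2].
have step (a b : int) : `|a - b| <= 1 ->
    exists2 p : seq int, forall e, path grid_adj (a, e) [seq (t, e) | t <- p] /\
        path grid_adj (e, a) [seq (e, t) | t <- p] &
      last a p = b /\ all (fun t => `|a - t| <= 1) p.
  move=> ab; have [->|nab] := eqVneq a b; first by exists [::].
  exists [:: b]; last by rewrite /= ab.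
  by move=> e; rewrite /= /grid_adj /= !eqxx /= !andbT; lia.
have [p P [lp ap]] := step c1 v1 h1; have [q Q [lq aq]] := step c2 v2 h2.
have L1 (a e : int) s : last (a, e) [seq (t, e) | t <- s] = (last a s, e).
  by elim: s a => //= t s IH a; rewrite IH.
have L2 (a e : int) s : last (e, a) [seq (e, t) | t <- s] = (e, last a s).
  by elim: s a => //= t s IH a; rewrite IH.
exists ([seq (t, c2) | t <- p] ++ [seq (v1, t) | t <- q]); split.
- by rewrite cat_path L1 lp (P c2).1 (Q v1).2.
- by rewrite last_cat L1 lp L2 lq.
- rewrite all_cat !all_map; apply/andP; split.
    by apply: sub_all ap => t /= ax; rewrite /cell_near /= subrr normr0 ax.
  by apply: sub_all aq => t /= ax; rewrite /cell_near /= h1 ax.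
Qed.

Lemma linkedP (T : eqType) (e : rel T) (A : pred T) (a b : T) p : symmetric e ->
  a \in A -> [/\ path e a p, last a p = b & all A p] ->
  exists p', [/\ path e b p', last b p' = a & all A p'].
Proof.
move=> es vA [vp vw Ap]; exists (rev (belast a p)); split.
- by rewrite -vw rev_path; under eq_path do rewrite es.
- by case: p vp vw Ap => [_ <- //|x p] _ _ _; rewrite /= rev_cons last_rcons.
- rewrite all_rev; apply/allP => y /mem_belast; rewrite inE => /orP[/eqP->//|].
  exact: allP.
Qed.

Lemma mesh_linked h K : 0 < h -> connected K -> linked grid_adj (mesh h K).
Proof.
move=> h0 cK.
pose reach v w := exists p, [/\ path grid_adj v p, last v p = w &
  all (mesh h K) p].
have trans u v w : reach u v -> reach v w -> reach u w.
  move=> [p [up uv Ap]] [q [vq vw Aq]]; exists (p ++ q); split.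
  - by rewrite cat_path up uv.
  - by rewrite last_cat uv.
  - by rewrite all_cat Ap.
have sym u v : u \in mesh h K -> reach u v -> reach v u.
  by move=> uK [p] /(linkedP grid_adj_sym uK).
have near x v : K x -> cell_near (cell h x) v -> reach (cell h x) v.
  move=> Kx /cell_near_path[p [xp xv ap]]; exists p; split=> //.
  by apply: sub_all ap => w xw; apply/asboolP; exists x.
have cells x y : K x -> K y -> reach (cell h x) (cell h y).
  move=> Kx Ky; apply: contrapT => nxy.
  have [] := @connected_fine_chained _ _ h K h0 cK [set z | reach (cell h x)
    (cell h z)].
  - by exists x; split=> //; exists [::].
  - by exists y.
  move=> p [q [Kp Pp Kq nPq pq]]; apply: nPq; apply: trans Pp _.
  by apply: near => //; exact: ball_cell_near.
move=> v w vK wK.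
have /asboolP[x Kx xv] := vK; have /asboolP[y Ky yw] := wK.
apply: (trans _ _ _ _ (near _ _ Ky yw));
  apply: (trans _ _ _ _ (cells _ _ Kx Ky)).
by apply: sym (near _ _ Kx xv); exact: mesh_cell.
Qed.

(** The discrete form of the constancy of the winding number on a connected set that keeps away from
    the loop. *)
Lemma loop_cross_mesh h K L a p p' v w : 0 < h -> connected K ->
  (forall x y, K x -> L y -> ~ ball x (6 * h) y) ->
  grid_loop a p p' -> all (mesh h L) (a :: p ++ p') ->
  v \in mesh h K -> w \in mesh h K ->
  loop_cross v a p p' = loop_cross w a p p'.
Proof.
move=> h0 cK KL lp aL vK wK.
have [q [vq <- aq]] := mesh_linked h0 cK vK wK.
apply: loop_cross_path => // u uq.
have uK : u \in mesh h K by move: uq; rewrite inE => /orP[/eqP->//|];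
  exact: allP.
by apply/negP => /(allP aL) uL; move: (mesh_disjoint h0 KL uK);
  rewrite [_ \in _]uL.
Qed.

End discretization.

(** * Parities of loops around points of the unbounded domain *)

Section plane.
Variable R : realType.
Implicit Types (x y : R * R) (h : R) (K L X : set (R * R)).

Lemma continuous_pair (S T1 T2 : topologicalType) (f : S -> T1) (g : S -> T2) :
  continuous f -> continuous g -> continuous (fun t => (f t, g t)).
Proof. by move=> cf cg t; exact: cvg_pair (cf t) (cg t). Qed.

Lemma segment_in_ball x y r : ball x r y ->
  exists K, [/\ connected K, K x, K y & K `<=` ball x r].
Proof.
move=> xy; pose f (t : R) : R * R :=
  (x.1 + t * (y.1 - x.1), x.2 + t * (y.2 - x.2)).
have cf : continuous f.
  apply: continuous_pair => t; (apply: cvgD; first exact: cvg_cst);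
    (apply: cvgM; [exact: cvg_id|exact: cvg_cst]).
exists (f @` `[0, 1]); split.
- apply: connected_continuous_connected; first exact: segment_connected.
  exact: continuous_subspaceT.
- exists 0; first by rewrite /= in_itv /= lexx ler01.
  by rewrite /f !mul0r !addr0; case: x {xy f cf}.
- exists 1; first by rewrite /= in_itv /= lexx ler01.
  by rewrite /f !mul1r !(addrC x.1, addrC x.2) !subrK; case: y {xy f cf}.
- move=> _ [t /= t01 <-]; move: t01; rewrite in_itv /= => /andP[t0 t1].
  have key (a b : R) : `|a - b| < r -> `|a - (a + t * (b - a))| < r.
    move=> ab; rewrite opprD addNKr normrN normrM ger0_norm // distrC.
    by apply: le_lt_trans ab; rewrite ler_piMl.
  by case: xy => xy1 xy2; split; exact: key.
Qed.

(** The trace at mesh [h] of not being enclosed by [X]. *)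
Definition unwound X h (u : R * R) := forall a p p', grid_loop a p p' ->
  all (mesh h X) (a :: p ++ p') -> loop_cross (cell h u) a p p' = false.

Lemma unwound_ball X u v r h : 0 < h -> (forall x, X x ->
  ~ ball u (r + 6 * h) x) ->
  ball u r v -> unwound X h u -> unwound X h v.
Proof.
move=> h0 far uv un a p p' lp ap; rewrite -(un a p p' lp ap).
have [K [cK Ku Kv KB]] := segment_in_ball uv.
apply: (@loop_cross_mesh _ h K X) => //; try exact: mesh_cell.
by move=> x y Kx Xy xy; apply: (far y Xy); apply: ball_triangle xy; exact: KB.
Qed.

(** Balls of the product are squares, so [u] has a coordinate of size at least [M + 6]. The loop
    stays within [M + 3], since the mesh strays less than [3 * h] from [X]; hence it lies on one
    side of the cell of [u]. *)
Lemma unwound_far X (M : R) h u : 0 < h -> h < 1 -> (forall x, X x ->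
  ball (0 : R, 0 : R) M x) ->
  ~ ball (0 : R, 0 : R) (M + 6) u -> unwound X h u.
Proof.
move=> h0 h1 XM uM a p p' lp ap; apply: loop_cross_outside => //.
have near v : v \in a :: p ++ p' ->
  `|h * v.1%:~R| < M + 3 /\ `|h * v.2%:~R| < M + 3.
  move/(allP ap) => /(meshP h0)[x /XM Mx xv].
  have [] : ball (0 : R,
    0 : R) (M + 3) (grid_point h v) by apply: ball_trans Mx xv _; lra.
  by rewrite /ball /= !sub0r !normrN.
have out (c : R) : M + 6 <= `|c| -> (forall m : int, `|h * m%:~R| < M + 3 ->
  m <= Num.floor (c / h)) \/
   (forall m : int, `|h * m%:~R| < M + 3 -> Num.floor (c / h) < m).
  have /andP[] := floor_itv (c / h); rewrite ler_pdivlMr // ltr_pdivrMr //.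
  set n := Num.floor _; rewrite intrD => n1 n2.
  rewrite ler_normr => /orP[c0|c0]; [left|right] => m.
    rewrite ltr_norml => /andP[m1 m2]; suff : m < n + 1 by lia.
    by rewrite -(ltr_int R) intrD; nra.
  rewrite ltr_norml => /andP[m1 m2].
  by rewrite -(ltr_int R); nra.
have : M + 6 <= `|u.1| \/ M + 6 <= `|u.2|.
  apply: contrapT => /not_orP[/negP + /negP]; rewrite -!ltNge => u1 u2.
  by apply: uM; split; rewrite /= /ball /= sub0r normrN.
case=> /out[] o.
- by left=> v /near[v1 _]; exact: o.
- by right; left=> v /near[v1 _]; exact: o.
- by right; right; left=> v /near[_ v2]; exact: o.
- by right; right; right=> v /near[_ v2]; exact: o.
Qed.

Definition outer_domain X (U : set (R * R)) :=
  [/\ open U, connected U, (forall M : R, exists2 u, U u & ~ ball (0 : R,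
    0 : R) M u),
      U `&` X = set0 & X `<=` closure U].

Lemma compact_in_ball X : compact X ->
  exists M : R, X `<=` ball (0 : R, 0 : R) M.
Proof.
move=> /compact_bounded [M [_ /(_ (M + 1))]]; rewrite ltrDl => /(_ ltr01) XM.
exists (M + 1 + 1) => x /XM; rewrite /= prod_normE ge_max => /andP[x1 x2].
by split; rewrite /ball /= sub0r normrN ltr_pwDr.
Qed.

(** The points with this property form a relatively clopen subset of [U], since close points of [U]
    have equal parities for all small [h]; and it contains points far out. *)
Lemma outer_domain_unwound X U u : compact X -> outer_domain X U -> U u ->
  \forall h \near 0^'+, unwound X h u.
Proof.
move=> cX [oU cU Uinf UX XU].
pose G := [set v | \forall h \near 0^'+, unwound X h v].
suff UG : U `&` G = U by rewrite -UG => -[].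
have loc v : U v -> exists2 r, 0 < r &
    forall w, ball v r w -> [/\ U w, G v -> G w & G w -> G v].
  move=> Uv; have : nbhs v U by exact: open_nbhs_nbhs.
  rewrite -nbhs_ballE => -[r /= r0 rU].
  have rX x : X x -> ~ ball v r x.
    by move=> Xx /rU Ux; have : set0 x by rewrite -UX.
  exists (r / 4) => [|w vw]; first by rewrite divr_gt0.
  have h8 : \forall h \near 0^'+, 12 * h < r.
    near=> h; rewrite mulrC -ltr_pdivlMr //.
    by near: h; apply: nbhs_right_lt; rewrite divr_gt0.
  split; first by apply: rU; apply: le_ball vw; lra.
  - move=> Gv; near=> h; apply: (@unwound_ball _ v w (r / 4)) => //.
    + move=> x /rX vx ux; apply: vx; apply: le_ball ux.
      by have : 12 * h < r; [near: h|lra].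
    + by near: h.
  - move=> Gw; near=> h; apply: (@unwound_ball _ w v (r / 4)) => //.
    + move=> x /rX vx ux; apply: vx; apply: ball_trans vw ux _.
      by have : 12 * h < r; [near: h|lra].
    + exact: ball_sym.
    + by near: h.
have opn (P : set (R * R)) : P `<=` U ->
    (forall v r, P v -> 0 < r ->  (forall w, ball v r w -> [/\ U w, G v ->
      G w & G w -> G v]) ->
       ball v r `<=` P) -> open P.
  move=> PU h; rewrite openE => v Pv; rewrite /interior -nbhs_ballE.
  by have [r r0 F] := loc v (PU _ Pv); exists r => //; exact: h Pv r0 F.
apply: cU.
- have [M XM] := compact_in_ball cX.
  have [u0 Uu0 u0M] := Uinf (M + 6); exists u0; split=> //.
  near=> h; apply: (unwound_far _ _ _ u0M) => //.
- exists (U `&` G); last by rewrite setIA setIid.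
  apply: opn => [v []//|v r [Uv Gv] r0 h w /h[Uw vw _]].
  by split=> //; exact: vw.
- exists (~` (U `\` G)).
    apply: open_closedC; apply: opn => [v []//|v r [Uv Gv] r0 h w /h[Uw _ wv]].
    by split=> // /wv.
  apply/seteqP; split=> v [Uv]; first by move=> Gv; split=> // -[].
  by move=> nG; split=> //; apply: contrapT => nGv; apply: nG.
Unshelve. all: by end_near.
Qed.

(** How small [h] must be depends on the point of [U]; compactness of [X] makes one bound serve all
    of [X]. *)
Lemma outer_domain_near X U (d : R) : compact X -> outer_domain X U -> 0 < d ->
  \forall h \near 0^'+, X `<=` [set x | exists2 u, ball x d u & unwound X h u].
Proof.
move=> cX dU d0; have /compact_near_coveringP cov := cX.
apply: cov => x Xx.
have [_ _ _ _ /(_ x Xx)/(_ (ball x (d / 2)))[|u [Uu xu]]] := dU.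
  by apply: nbhsx_ballx; rewrite divr_gt0.
exists (ball x (d / 2), [set h | unwound X h u]).
  split=> /=; first by apply: nbhsx_ballx; rewrite divr_gt0.
  exact: outer_domain_unwound dU Uu.
move=> [y h] /= [xy uh]; exists u => //.
by apply: ball_trans (ball_sym xy) xu _; lra.
Qed.

End plane.

(** * Exclusion of theta shapes *)

Section theta.
Variable R : realType.
Implicit Types (x y : R * R) (h : R) (K L X : set (R * R)).

(* One of the three arms would lie inside the loop formed by the other two,
   out of reach of [U]. *)
Lemma no_theta X U A B F1 F2 F3 : compact X -> outer_domain X U ->
  A `<=` X -> B `<=` X -> F1 `<=` X -> F2 `<=` X -> F3 `<=` X ->
  compact A -> compact F1 -> compact F2 -> closed B -> closed F2 -> closed F3 ->
  connected A -> connected B -> connected F1 -> connected F2 -> connected F3 ->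
  A `&` B = set0 -> F1 `&` F2 = set0 -> F1 `&` F3 = set0 -> F2 `&` F3 = set0 ->
  F1 `&` A !=set0 -> F2 `&` A !=set0 -> F3 `&` A !=set0 ->
  F1 `&` B !=set0 -> F2 `&` B !=set0 -> F3 `&` B !=set0 -> False.
Proof.
move=> cX dU AX BX F1X F2X F3X kA k1 k2 cB c2 c3 nA nB n1 n2 n3 AB F12 F13 F23.
move=> [u1 [u1F u1A]] [u2 [u2F u2A]] [u3 [u3F u3A]].
move=> [w1 [w1F w1B]] [w2 [w2F w2B]] [w3 [w3F w3B]].
have [r r0 rAB] := uniform_gap kA cB AB.
have [r12 r120 g12] := uniform_gap k1 c2 F12.
have [r13 r130 g13] := uniform_gap k1 c3 F13.
have [r23 r230 g23] := uniform_gap k2 c3 F23.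
pose m := Num.min (Num.min r r12) (Num.min r13 r23).
have m0 : 0 < m by rewrite !lt_min r0 r120 r130 r230.
have [mr m12 m13 m23] : [/\ m <= r, m <= r12, m <= r13 & m <= r23].
  by rewrite !ge_min !lexx ?orbT.
have rF12 x y : F1 x -> F2 y -> ~ ball x m y.
  by move=> Fx Fy xy; exact: g12 Fx Fy (le_ball m12 xy).
have rF13 x y : F1 x -> F3 y -> ~ ball x m y.
  by move=> Fx Fy xy; exact: g13 Fx Fy (le_ball m13 xy).
have rF23 x y : F2 x -> F3 y -> ~ ball x m y.
  by move=> Fx Fy xy; exact: g23 Fx Fy (le_ball m23 xy).
have {}rAB x y : A x -> B y -> ~ ball x m y.
  by move=> Ax By xy; exact: rAB Ax By (le_ball mr xy).
(* Three scales: [h] is small against [d], and [d] against the gap [m]. Test points lie about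
   [3 * d] from [A], so moving them by about [d] keeps them off [A], and off [B] since [4 * d] plus
   a few [h] is below [m]. *)
pose d := m / 10; have d0 : 0 < d by rewrite divr_gt0.
suff : \forall h \near (0 : R)^'+, False by move/filter_ex => [].
have hd : \forall h \near (0 : R)^'+, 20 * h < d.
  near=> h; rewrite mulrC -ltr_pdivlMr //.
  by near: h; apply: nbhs_right_lt; rewrite divr_gt0.
near=> h.
have h0 : 0 < h by [].
have hd20 : 20 * h < d by near: h.
have out : X `<=` [set x | exists2 u, ball x d u & unwound X h u].
  by near: h; exact: outer_domain_near dU d0.
have dm : 10 * d = m by rewrite /d; lra.
pose N : pred (int * int) :=
  fun v => `[< exists2 x, A x & ball x (3 * d) (grid_point h v) >].
have gap6 K L : (forall x y, K x -> L y -> ~ ball x m y) ->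
    {in mesh h K, forall v, v \notin mesh h L}.
  move=> KL; apply: mesh_disjoint => // x y Kx Ly xy; apply: (KL x y) => //.
  by apply: le_ball xy; lra.
have AN : {subset mesh h A <= N}.
  move=> v /(meshP h0)[x Ax xv]; apply/asboolP; exists x => //.
  by apply: le_ball xv; lra.
have NB v v' : v \in N -> v' \in mesh h B -> ~~ grid_adj v v'.
  move=> /asboolP[x Ax xv] /(meshP h0)[y By yv]; apply/negP =>
    /(grid_adj_ball h0) vv.
  by apply: (rAB x y Ax By);
    apply: ball_trans (ball_trans xv vv (lexx _)) (ball_sym yv) _; lra.
have BN : {in mesh h B, forall v, v \notin N}.
  move=> v /(meshP h0)[y By yv]; apply/negP => /asboolP[x Ax xv].
  by apply: (rAB x y Ax By); apply: ball_trans xv (ball_sym yv) _; lra.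
have cellm K x : K x -> cell h x \in mesh h K by exact: mesh_cell.
have [a [t1 [t2 [t3 [q1 [q2 [q3 [[l12 l23 l13] [aA a1 a2 a3] [Q1 Q2 Q3] QN
  tw]]]]]]]] :=
  theta_lattice (mesh_linked h0 nA) (mesh_linked h0 nB) (mesh_linked h0 n1)
    (mesh_linked h0 n2) (mesh_linked h0 n3)
    (cellm _ _ u1F) (cellm _ _ u1A) (cellm _ _ w1F) (cellm _ _ w1B)
    (cellm _ _ u2F) (cellm _ _ u2A) (cellm _ _ w2F) (cellm _ _ w2B)
    (cellm _ _ u3F) (cellm _ _ u3A) (cellm _ _ w3F) (cellm _ _ w3B)
    (gap6 _ _ rAB) (gap6 _ _ rF12) (gap6 _ _ rF13) (gap6 _ _ rF23) AN BN NB.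
have inY K L t t' : all [predU predU (mesh h A) (mesh h B) & mesh h K] t ->
    all [predU predU (mesh h A) (mesh h B) & mesh h L] t' ->
    all (mesh h (A `|` B `|` K `|` L)) (a :: t ++ t').
  move=> tK tL; apply/allP => v; rewrite inE mem_cat =>
    /orP[/eqP->|/orP[/(allP tK)|/(allP tL)]].
  - by apply: mesh_sub aA => x Ax; left; left; left.
  - case/orP => [/orP[]|] vm; apply: (mesh_sub _ vm) => x xm; [left; left;
    left|left; left; right|left; right]; exact: xm.
  - case/orP => [/orP[]|] vm; apply: (mesh_sub _ vm) => x xm; [left; left;
    left|left; left; right|right]; exact: xm.
(* A segment leads from a point of [F] near [q] to an unwound point. It avoids [A] because [q] is
   outside [N], [B] because [q] is next to [N], and the fibres of the two arms by the gap [m]. *)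
have zero F K L q t t' : F `<=` X -> K `<=` X -> L `<=` X ->
    (forall x y, F x -> K y -> ~ ball x m y) -> (forall x y, F x -> L y ->
      ~ ball x m y) ->
    all [predU predU (mesh h A) (mesh h B) & mesh h K] t ->
    all [predU predU (mesh h A) (mesh h B) & mesh h L] t' ->
    grid_loop a t t' -> q \in mesh h F -> 
    q \notin N /\ (exists2 y, y \in N & grid_adj y q) ->
      loop_cross q a t t' = false.
  move=> FX KX LX FK FL tK tL lp /asboolP[x Fx xq] [qN [y /asboolP[z Az zy]
    yq]].
  have [u xu uu] := out x (FX x Fx).
  have [S [cS Sx Su SB]] := segment_in_ball xu.
  have tY := inY _ _ _ _ tK tL.
  have xq3 := cell_near_ball h0 xq.
  rewrite (@loop_cross_mesh _ h S (A `|` B `|` K `|` L) a t t' q (cell h u)) //.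
  - apply: uu => //; apply: sub_all tY; apply: mesh_sub.
    by move=> v [[[/AX|/BX]|/KX]|/LX].
  - move=> k l /SB xk [[[Al|Bl]|Kl]|Ll] kl.
    + move/negP: qN; apply; apply/asboolP; exists l => //.
      by apply: ball_trans (ball_sym (ball_trans xk kl (lexx _))) xq3 _; lra.
    + apply: (rAB z l Az Bl).
      have zq := ball_trans zy (grid_adj_ball h0 yq) (lexx _).
      have zx := ball_trans zq (ball_sym xq3) (lexx _).
      by apply: ball_trans zx (ball_trans xk kl (lexx _)) _; lra.
    + by apply: (FK x l Fx Kl); apply: ball_trans xk kl _; lra.
    + by apply: (FL x l Fx Ll); apply: ball_trans xk kl _; lra.
  - by apply/asboolP; exists x.
  - exact: mesh_cell.
have symb F K : (forall x y, F x -> K y -> ~ ball x m y) ->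
  forall x y, K x -> F y -> ~ ball x m y.
  by move=> FK x y Kx Fy /ball_sym; exact: FK.
move: tw; rewrite (zero F3 F1 F2 q3 t1 t2) ?(zero F1 F2 F3 q1 t2 t3)
  ?(zero F2 F1 F3 q2 t1 t3) //; try exact: symb.
- by apply: QN; rewrite !inE eqxx ?orbT.
- by apply: QN; rewrite !inE eqxx ?orbT.
- by apply: QN; rewrite !inE eqxx ?orbT.
Unshelve. all: by end_near.
Qed.

End theta.

(** * Limits of continua along an ultrafilter *)

Section ultralimit.
Variables (R : realType) (T : pseudoMetricType R).
Hypothesis cT : compact [set: T].
Variables (I : Type) (U : set_system I).
Hypothesis UU : UltraFilter U.

Lemma ultra_point (w : I -> T) : exists x, forall e : R, 0 < e ->
  U [set i | ball x e (w i)].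
Proof.
have [x [_ xc]] := cT (F := w @ U) _ filterT.
exists x => e e0; have [//|nU] := in_ultra_setVsetC [set i | ball x e (w i)] UU.
have [|y []] := xc (~` ball x e) (ball x e) _ (nbhsx_ballx x e e0);
  first exact: nU.
by [].
Qed.

(** Along an ultrafilter the lower and the upper limit of a family of sets coincide; this is their
    common value. *)
Definition ultra_lim (C : I -> set T) : set T :=
  [set x | forall e : R, 0 < e -> U [set i | C i `&` ball x e !=set0]].

Lemma ultra_lim_point (C : I -> set T) (w : I -> T) x : U [set i | C i (w i)] ->
  (forall e : R, 0 < e -> U [set i | ball x e (w i)]) -> ultra_lim C x.
Proof. by move=> Cw xw e e0; apply: filterS2 Cw (xw e e0) => i;
  exists (w i). Qed.

Lemma closed_ultra_lim (C : I -> set T) : closed (ultra_lim C).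
Proof.
move=> x xc e e0; have e2 : 0 < e / 2 by rewrite divr_gt0.
have [y [/(_ _ e2) yC xy]] := xc _ (nbhsx_ballx x _ e2).
apply: filterS yC => i [z [Cz yz]]; exists z; split=> //.
by apply: ball_trans xy yz _; lra.
Qed.

(** If the limit split into two compact pieces at distance [r], almost all [C i] would lie in the
    [r / 3]-neighbourhoods of the pieces and meet both, which an [r / 3]-chain cannot do. *)
Lemma connected_ultra_lim (C : I -> set T) :
  (forall e : R, 0 < e -> U [set i | fine_chained e (C i)]) ->
  connected (ultra_lim C).
Proof.
move=> fC; apply/connectedP => E [E0 EU [E01 E10]].
have cE b : closed (E b).
  have sub : closure (E b) `<=` ultra_lim C.
    rewrite [X in _ `<=` X](closure_id _).1; last exact: closed_ultra_lim.
    by apply: closureS; rewrite EU; case: b => x; [right|left].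
  move=> x xE; have := sub _ xE; rewrite EU; case: b xE {sub} => xE [] Ex //.
    by have : set0 x by rewrite -E10.
  by have : set0 x by rewrite -E01.
have kE b : compact (E b) by exact: subclosed_compact (cE b) cT _.
have dE : E false `&` E true = set0.
  by apply/seteqP; split=> // x [Fx Tx]; rewrite -E10; split=> //;
    exact: subset_closure.
have [r r0 gap] := uniform_gap (kE false) (cE true) dE.
have r3 : 0 < r / 3 by rewrite divr_gt0.
pose O b := [set x | exists2 a, E b a & ball a (r / 3) x].
(* Otherwise points of [C i] outside both neighbourhoods would converge to a point of the limit set
   far from both pieces. *)
have inO : U [set i | C i `<=` O false `|` O true].
  have [//|bad] := in_ultra_setVsetC [set i | C i `<=` O false `|` O true] UU.
  have [x0 _] := E0 true.
  have wit i : exists w, ~ (C i `<=` O false `|` O true) ->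
    C i w /\ ~ (O false `|` O true) w.
    have [?|/existsNP[w /not_implyP wP]] :=
      pselect (C i `<=` O false `|` O true).
      by exists x0.
    by exists w.
  pose w i := projT1 (cid (wit i)).
  have wP i : ~ (C i `<=` O false `|` O true) ->
    C i (w i) /\ ~ (O false `|` O true) (w i).
    by rewrite /w; case: cid.
  have [x xw] := ultra_point w.
  have Lx : ultra_lim C x.
    by apply: ultra_lim_point xw; apply: filterS bad => i /wP[].
  have [i [/= xwi /wP[_]]] := filter_ex (filterI (xw _ r3) bad).
  move: Lx; rewrite EU => -[] Ex []; [left|right]; by exists x.
have meet b : U [set i | C i `&` O b !=set0].
  have [a Ea] := E0 b.
  have /(_ _ r3) : ultra_lim C a by rewrite EU; case: (b) Ea; [right|left].
  by apply: filterS => i [x [Cx ax]]; exists x; split=> //; exists a.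
have [i [[[/= iO im0] [y [Cy Oy]]] ifn]] :=
  filter_ex (filterI (filterI (filterI inO (meet false)) (meet true)) (fC _
    r3)).
have [] := ifn (O false) im0.
  exists y; split=> // -[a Ea ay]; have [b Eb yb] := Oy.
  by apply: (gap a b) => //; apply: ball_trans ay (ball_sym yb) _; lra.
move=> p [q [Cp [a Ea ap] Cq nOq pq]].
have [//|[b Eb bq]] := iO _ Cq.
by apply: (gap a b) => //;
  apply: ball_trans (ball_trans ap pq (lexx _)) (ball_sym bq) _; lra.
Qed.

End ultralimit.

Lemma free_ultrafilter : exists U : set_system nat, UltraFilter U /\
  forall n, U [set m | (n <= m)%N].
Proof.
have [U [UU oU]] := @ultraFilterLemma nat \oo _.
by exists U; split=> // n; apply: oU; exists n.
Qed.

(** The points reached from [u] by [e]-chains in [L], as the least set closed under steps. *)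
Definition chain_component (R : numDomainType) (T : pseudoMetricType R) (e : R)
    (L : set T) (u : T) : set T :=
  [set v | L v /\ forall P : set T, P u ->
    (forall x y, P x -> L x -> L y -> ball x e y -> P y) -> P v].

Lemma chain_component_step (R : numDomainType) (T : pseudoMetricType R) (e : R)
  (L : set T) (u v w : T) : chain_component e L u v -> L w -> ball v e w ->
  chain_component e L u w.
Proof. by move=> [Lv uv] Lw vw; split=> // P Pu PS; apply: (PS v) => //;
  exact: uv. Qed.

Lemma chain_component_fine (R : numDomainType) (T : pseudoMetricType R) (e : R)
  (L : set T) (u : T) : fine_chained e (chain_component e L u).
Proof.
move=> P [x [ux Px]] [y [uy nPy]]; apply: contrapT => nex.
have far p q : chain_component e L u p -> P p -> chain_component e L u q ->
  ~ P q ->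
    ~ ball p e q.
  by move=> up Pp uq nPq pq; apply: nex; exists p, q.
have [Lx xP] := ux; have [Ly yP] := uy.
have [Pu|nPu] := pselect (P u).
  (* The implication from [L v] makes room for the starting point [u], which is not assumed to lie
     in [L]. *)
  apply: nPy; suff [] : ([set v | P v /\ (L v ->
    chain_component e L u v)]) y by [].
  apply: yP; first by split=> // Lu; split.
  move=> p q [Pp /[swap] Lp /(_ Lp) up] Lq pq.
  have uq := chain_component_step up Lq pq; split=> //.
  by apply: contrapT => nPq; exact: far pq.
suff [] : ([set v | ~ P v /\ (L v -> chain_component e L u v)]) x by [].
apply: xP; first by split=> // Lu; split.
move=> p q [Pp /[swap] Lp /(_ Lp) up] Lq pq.
have uq := chain_component_step up Lq pq; split=> // Pq.
exact: far (ball_sym pq).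
Qed.

(** * Subcontinua that cross an annulus *)

Section crossing.
Variables (R : realType) (Z : metricType R).
Implicit Types (L M : set Z) (c : Z) (a b e : R).

Lemma mdist_ball (x y : Z) e : ball x e y <-> mdist x y < e.
Proof. by rewrite ballEmdist. Qed.

(** If no chain component inside the annulus crossed it, the points within radius [a], together with
    all those reached from such points in the annulus, could not be left by an [e]-step. The margins
    [e] leave room for a step that passes over one of the radii. *)
Lemma crossing_chain L c a b e : fine_chained e L -> 0 < e -> e < b - a ->
  (exists2 p, L p & mdist c p <= a) -> (exists2 q, L q & b <= mdist c q) ->
  exists C, [/\ C `<=` L, fine_chained e C,
    (forall w, C w -> a - e <= mdist c w <= b + e),
    (exists2 u, C u & mdist c u <= a) & (exists2 v, C v & b <= mdist c v)].
Proof.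
move=> fL e0 eab [p Lp pa] [q Lq bq].
pose L' := [set w | L w /\ a - e <= mdist c w <= b + e].
apply: contrapT => nC.
have no u v : L' u -> mdist c u <= a -> chain_component e L' u v ->
  mdist c v < b.
  move=> L'u ua uv; rewrite ltNge; apply/negP => bv; apply: nC.
  exists (chain_component e L' u); split.
  - by move=> w [[]].
  - exact: chain_component_fine.
  - by move=> w [[]].
  - by exists u => //; split.
  - by exists v.
pose P := [set v | mdist c v <= a \/
  exists u, [/\ L' u, mdist c u <= a & chain_component e L' u v]].
have [] := fL P.
- by exists p; split=> //; left.
- exists q; split=> // -[qa|[u [L'u ua uq]]]; first lra.
  by have := no _ _ L'u ua uq; lra.
move=> v [w [Lv Pv Lw nPw /mdist_ball vw]].
have aw : a < mdist c w by rewrite ltNge; apply/negP => wa; apply: nPw; left.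
have t1 := metric_triangle c v w; have t2 := metric_triangle c w v.
rewrite (metric_sym w v) in t2.
case: Pv => [va|[u [L'u ua uv]]]; apply: nPw; right.
  have L'v : L' v by split=> //; apply/andP; split; lra.
  have L'w : L' w by split=> //; apply/andP; split; lra.
  exists v; split=> //; split=> // Q Qv QS; apply: (QS v) => //.
  exact/mdist_ball.
have vb := no _ _ L'u ua uv.
exists u; split=> //; apply: chain_component_step uv _ _.
  by split=> //; apply/andP; split; lra.
exact/mdist_ball.
Qed.

(** A form of the boundary bumping theorem: the continuum is a limit of crossing chain components,
    whose step and margin tend to 0. *)
Lemma crossing_continuum L c a b : compact [set: Z] -> closed L ->
  connected L -> a < b ->
  (exists2 p, L p & mdist c p <= a) -> (exists2 q, L q & b <= mdist c q) ->
  exists M, [/\ M `<=` L, continuum M, (forall w, M w -> a <= mdist c w <= b),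
    (exists2 u, M u & mdist c u = a) & (exists2 v, M v & mdist c v = b)].
Proof.
move=> cZ cL nL ab hp hq.
have [U [UU Un]] := free_ultrafilter.
pose e n : R := n.+1%:R^-1.
have e0 n : 0 < e n by rewrite invr_gt0.
have small d : 0 < d -> U [set n | e n < d].
  by move=> /invS_small[n hn]; apply: filterS (Un n) => k /hn.
have [p0 _ _] := hp.
have wit n : exists C u v, e n < b - a -> [/\ C `<=` L, fine_chained (e n) C,
    (forall w, C w -> a - e n <= mdist c w <= b + e n),
    C u /\ mdist c u <= a & C v /\ b <= mdist c v].
  (* Dummy values for the indices with too large a step, which the free ultrafilter ignores. *)
  have [en|_] := boolP (e n < b - a); last by exists set0, p0, p0.
  have [C [C1 C2 C3 [u Cu ua] [v Cv bv]]] :=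
    crossing_chain (connected_fine_chained (e0 n) nL) (e0 n) en hp hq.
  by exists C, u, v.
have [C {}wit] := choice wit; have [u {}wit] := choice wit;
  have [v {}wit] := choice wit.
have wU : U [set n | e n < b - a] by apply: small; lra.
have gt d : 0 < d -> U [set n | e n < d /\ e n < b - a].
  by move=> d0; apply: filterI => //; exact: small.
have inL x : ultra_lim U C x -> L x.
  move=> xC; rewrite (closure_id L).1 // => B /nbhs_ballP[d /= d0 dB].
  have [n [/= en [y [Cy xy]]]] := filter_ex (filterI wU (xC _ d0)).
  by have [CL _ _ _ _] := wit n en; exists y; split; [exact: CL|exact: dB].
have bnd x : ultra_lim U C x -> a <= mdist c x <= b.
  move=> xC; apply/andP; split; apply/ler_addgt0Pl => d d0.
    have d2 : 0 < d / 2 by rewrite divr_gt0.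
    have [n [/= [en en'] [y [Cy /mdist_ball xy]]]] :=
      filter_ex (filterI (gt _ d2) (xC _ d2)).
    have [_ _ /(_ y Cy)/andP[h1 _] _ _] := wit n en'.
    by have := metric_triangle c x y; lra.
  have d2 : 0 < d / 2 by rewrite divr_gt0.
  have [n [/= [en en'] [y [Cy /mdist_ball xy]]]] :=
    filter_ex (filterI (gt _ d2) (xC _ d2)).
  have [_ _ /(_ y Cy)/andP[_ h1] _ _] := wit n en'.
  by have := metric_triangle c y x; rewrite (metric_sym y); lra.
have lim_dist (w : nat -> Z) : U [set n | C n (w n)] ->
    exists2 x, ultra_lim U C x & forall d, 0 < d ->
      U [set n | mdist x (w n) < d].
  move=> wC; have [x xw] := ultra_point cZ UU w; exists x.
    exact: ultra_lim_point xw.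
  by move=> d d0; apply: filterS (xw d d0) => n /mdist_ball.
have [x Cx xu] : exists2 x, ultra_lim U C x & forall d, 0 < d ->
  U [set n | mdist x (u n) < d].
  by apply: lim_dist; apply: filterS wU => n /wit[_ _ _ []].
have [y Cy yv] : exists2 x, ultra_lim U C x & forall d, 0 < d ->
  U [set n | mdist x (v n) < d].
  by apply: lim_dist; apply: filterS wU => n /wit[_ _ _ _ []].
exists (ultra_lim U C); split=> //.
- split; first split.
  + by exists x.
  + by apply: (subclosed_compact _ cZ) => //; apply: closed_ultra_lim.
  + apply: connected_ultra_lim => // d d0; apply: filterS (gt _ d0) =>
    n [/= nd /wit[_ fC _ _ _]].
    move=> P hP hnP; have [s [t [Cs Ps Ct nPt st]]] := fC P hP hnP.
    by exists s, t; split=> //; apply: le_ball st; exact: ltW.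
- exists x => //; apply/eqP; rewrite eq_le; have /andP[-> _] := bnd _ Cx;
  rewrite andbT.
  apply/ler_addgt0Pl => d d0.
  have [n [/= xd /wit[_ _ _ [_ ua] _]]] := filter_ex (filterI (xu d d0) wU).
  by have := metric_triangle c (u n) x; rewrite (metric_sym (u n)); lra.
- exists y => //; apply/eqP; rewrite eq_le; have /andP[_ ->] := bnd _ Cy.
  apply/ler_addgt0Pl => d d0.
  have [n [/= xd /wit[_ _ _ _ [_ ua]]]] := filter_ex (filterI (yv d d0) wU).
  by have := metric_triangle c y (v n); lra.
Qed.

End crossing.

Definition pairwise_disjoint (T : Type) (F : set (set T)) :=
  forall C D, F C -> F D -> C <> D -> C `&` D = set0.

Lemma disjoint_sequence (T : Type) (F : set (set T)) : infinite_set F ->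
  pairwise_disjoint F -> exists K : nat -> set T, (forall n, F (K n)) /\
    forall n m, n <> m -> K n `&` K m = set0.
Proof.
move=> /infiniteP/pcard_leP/injfunPex[K KF Kinj] Fd; exists K.
have FK n : F (K n) by exact: KF.
split=> // n m nm; apply: Fd => // e; apply: nm.
by apply: Kinj; rewrite ?inE.
Qed.

Lemma infinite_disjoint_sequence (T : Type) (K : nat -> set T) :
  (forall n, K n !=set0) -> (forall n m, n <> m -> K n `&` K m = set0) ->
  infinite_set (range K).
Proof.
move=> K0 Kd /(@finite_preimage _ _ _ K) h; apply: infinite_nat.
apply: sub_finite_set (h _); first by move=> n _; exists n.
move=> n m _ _ e; apply: contrapT => /Kd; rewrite e setIid => {}e.
by have [x] := K0 m; rewrite e.
Qed.

(** * Ramsey arguments with an ultrafilter *)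

Section greedy.
Variables (U : set_system nat) (UU : UltraFilter U).
Hypothesis Un : forall n, U [set m | (n <= m)%N].

(** The ultrafilter proof of Ramsey's theorem: finitely many indices chosen in [D] leave a large set
    of common successors, which meets [D] again. *)
Lemma greedy (S : nat -> nat -> Prop) : U [set n | U [set m | S n m]] ->
  exists f : nat -> nat, forall i j, (i < j)%N ->
    (f i < f j)%N /\ S (f i) (f j).
Proof.
move=> SU; pose D := [set n | U [set m | S n m]].
have wit (s : seq nat) : exists m, (forall n, n \in s -> D n) ->
    D m /\ forall n, n \in s -> (n < m)%N /\ S n m.
  have [sD|nsD] := pselect (forall n, n \in s -> D n); last by exists 0%N.
  suff : U [set m | forall n, n \in s -> (n < m)%N /\ S n m].
    by move=> /(filterI SU)/filter_ex[m [Dm hm]]; exists m.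
  elim: s sD => [|n s IH] sD; first by apply: filterS filterT => m _ n.
  have /IH hs : forall n', n' \in s -> D n' by move=> n' n's; apply: sD;
    rewrite inE n's orbT.
  have Dn : D n by apply: sD; rewrite mem_head.
  apply: filterS (filterI hs (filterI Dn (Un n.+1))) => m [h1 [h2 h3]] n'.
  by rewrite inE => /orP[/eqP->|/h1].
have [next nextP] := choice wit.
pose pre := fix pre k := if k is k'.+1 then next (pre k') :: pre k' else [::].
have preD k n : n \in pre k -> D n.
  elim: k n => //= k IH n; rewrite inE => /orP[/eqP->|/IH//].
  by have [] := nextP _ IH.
exists (fun k => next (pre k)) => i j ij.
have [_] := nextP (pre j) (preD j); apply.
elim: j ij => // j IH; rewrite ltnS leq_eqVlt => /orP[/eqP->|/IH];
  rewrite /= inE ?eqxx // => ->.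
by rewrite orbT.
Qed.

Lemma ultra_meet (T : Type) (M : nat -> set T) :
  (forall n, M n !=set0) ->
  (forall f : nat -> nat, injective f ->
    (forall n m, n <> m -> M (f n) `&` M (f m) = set0) -> False) ->
  U [set n | U [set m | M n `&` M m !=set0]].
Proof.
move=> M0 Mf; have [//|nU] :=
  in_ultra_setVsetC [set n | U [set m | M n `&` M m !=set0]] UU.
exfalso; have : U [set n | U [set m | M n `&` M m = set0]].
  apply: filterS nU => n /= nm.
  have [//|] := in_ultra_setVsetC [set m | M n `&` M m !=set0] UU.
  by apply: filterS => m /= /set0P/negP; rewrite negbK => /eqP.
move=> /greedy[f fP]; apply: (Mf f) => [i j|i j].
  by case: (ltngtP i j) => [/fP[h _] e|/fP[h _] e|//]; move: h; rewrite e ltnn.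
by case: (ltngtP i j) => [/fP[]//|/fP[_]|//]; rewrite setIC.
Qed.

End greedy.

Section diameter.
Variables (R : realType) (Z : metricType R).

Lemma compact_mdist_bounded (c : Z) : compact [set: Z] ->
  exists M : R, forall z, mdist c z <= M.
Proof.
move=> /compact_near_coveringP cov.
have : \forall M \near +oo, [set: Z] `<=` [set z | mdist c z <= M].
  apply: cov => z _; exists (ball z 1, [set M | mdist c z + 1 <= M]).
    by split; [exact: nbhsx_ballx|apply: nbhs_pinfty_ge; exact: num_real].
  move=> [w M] /= [/mdist_ball zw]; have := metric_triangle c z w; lra.
by move=> /filter_ex[M hM]; exists M => z; exact: hM.
Qed.

Lemma diam_ge (C : set Z) x y : compact [set: Z] -> C x -> C y ->
  mdist x y <= diam C.
Proof.
move=> cZ Cx Cy; have [M hM] := compact_mdist_bounded x cZ.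
apply: ub_le_sup; last by exists x, y.
exists (M + M) => _ [a [b [_ _ ->]]].
by have := metric_triangle a x b; have := hM a; have := hM b;
  rewrite (metric_sym a x); lra.
Qed.

Lemma diam_lt (C : set Z) e : C !=set0 -> e < diam C ->
  exists x y, [/\ C x, C y & e < mdist x y].
Proof.
move=> [x Cx] eC; apply: contrapT => nxy; move: eC; apply/negP; rewrite -leNgt.
apply: sup_le_ub; first by exists (mdist x x), x, x.
move=> _ [a [b [Ca Cb ->]]]; rewrite leNgt; apply/negP => eab.
by apply: nxy; exists a, b.
Qed.

End diameter.

(** * Monotone maps collapse limit-related points *)

(* Any two points of a limit of pairwise disjoint continua are related, and this
   form of the relation is closed by construction. *)
Definition limit_related (R : realType) (T : pseudoMetricType R) (x y : T) :=
  forall e : R, 0 < e -> exists F : set (set T), [/\ infinite_set F,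
    forall C, F C -> [/\ continuum C, C `&` ball x e !=set0 &
      C `&` ball y e !=set0] &
    pairwise_disjoint F].

Lemma continuum_image (S T : topologicalType) (f : S -> T) (C : set S) :
  continuous f -> continuum C -> continuum (f @` C).
Proof.
move=> cf [[[x Cx] kC] nC]; split; first split.
- by exists (f x), x.
- by apply: continuous_compact => //; exact: continuous_subspaceT.
- by apply: connected_continuous_connected => //; exact: continuous_subspaceT.
Qed.

Lemma continuous_ball (R : realType) (T : pseudoMetricType R) (Z : metricType R)
    (f : T -> Z) (x : T) (r : R) : continuous f -> 0 < r ->
  exists2 e : R, 0 < e & forall y, ball x e y -> mdist (f x) (f y) < r.
Proof.
move=> cf r0; have /cf : nbhs (f x) (ball (f x) r) by exact: nbhsx_ballx.
rewrite nbhs_simpl -nbhs_ballE => -[e e0 h]; exists e => // y /h.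
by move/mdist_ball.
Qed.

Section collapse.
Variables (R : realType) (T : pseudoMetricType R) (Z : metricType R).
Variables (X U : set (R * R)) (v : T -> R * R) (phi : T -> Z).
Hypotheses (cX : compact X) (dU : outer_domain X U).
Hypotheses (cv : continuous v) (iv : injective v) (vX : forall t, X (v t)).
Hypotheses (cphi : continuous phi) (cZ : compact [set: Z]).
Hypothesis fsZ : finitely_suslinian [set: Z].
Hypothesis fibers : forall z, continuum (phi @^-1` [set z]).

(** Each image contains a continuum that crosses the annulus and so has diameter at least [b - a].
    If these did not meet for almost all pairs, infinitely many of them would be pairwise
    disjoint. *)
Lemma ultra_meet_annulus (W : set_system nat) (K : nat ->
  set T) (c : Z) (a b : R) :
  UltraFilter W -> (forall n, W [set m | (n <= m)%N]) -> 
  (forall n, continuum (K n)) -> a < b ->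
  (forall n, exists2 t, K n t & mdist c (phi t) <= a) ->
  (forall n, exists2 t, K n t & b <= mdist c (phi t)) ->
  W [set n | W [set m | exists z, [/\ a <= mdist c z <= b, (phi @` K n) z &
    (phi @` K m) z]]].
Proof.
move=> UW Wn cK ab ha hb.
have wit n : exists M, [/\ M `<=` phi @` K n, continuum M,
    (forall w, M w -> a <= mdist c w <= b) & b - a <= diam M].
  have [[L0 kL] nL] := continuum_image cphi (cK n).
  have [M [ML cM Mab [u Mu ua] [w Mw wb]]] :
      exists M, [/\ M `<=` phi @` K n, continuum M, (forall w, M w ->
        a <= mdist c w <= b),
      (exists2 u, M u & mdist c u = a) & (exists2 v, M v & mdist c v = b)].
    apply: crossing_continuum => //.
    - by apply: compact_closed kL; exact: metric_hausdorff.
    - by have [t Kt ta] := ha n; exists (phi t) => //; exists t.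
    - by have [t Kt ta] := hb n; exists (phi t) => //; exists t.
  exists M; split=> //; apply: le_trans (diam_ge cZ Mu Mw).
  by have := metric_triangle c u w; rewrite ua wb; lra.
have [M {}wit] := choice wit.
have M0 n : M n !=set0 by have [_ [[]]] := wit n.
suff : W [set n | W [set m | M n `&` M m !=set0]].
  apply: filterS => n /=; apply: filterS => m [z [Mn Mm]]; exists z.
  by have [Ln _ /(_ z Mn) zab _] := wit n; have [Lm _ _ _] := wit m;
    split=> //; [exact: Ln|exact: Lm].
apply: ultra_meet => // f fi fd.
have [] := @infinite_disjoint_sequence _ (M \o f) (fun n => M0 (f n)) fd.
apply: (fsZ (e := b - a)); first by lra.
- by move=> _ [n _ <-] /=; have [_ ? _ ?] := wit (f n); split.
- move=> _ _ [n _ <-] [m _ <-] /= nm; apply: fd => e; apply: nm.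
  by rewrite e.
Qed.

Lemma limit_related_collapse (x y : T) : limit_related x y -> phi x = phi y.
Proof.
move=> xy; apply/eqP; apply: contrapT => /negP; rewrite -mdist_gt0.
set c := phi x; set r := mdist _ _ => r0.
have r10 : 0 < r / 10 by rewrite divr_gt0.
have [e1 e10 h1] := continuous_ball x cphi r10.
have [e2 e20 h2] := continuous_ball y cphi r10.
pose e := Num.min e1 e2; have e0 : 0 < e by rewrite lt_min e10.
have [F [Finf Fc Fd]] := xy e e0.
have [K [FK Kd]] := disjoint_sequence Finf Fd.
have [W [UW Wn]] := free_ultrafilter.
have cK n : continuum (K n) by have [] := Fc _ (FK n).
have near n : exists2 t, K n t & mdist c (phi t) <= r / 10.
  have [_ [t [Kt xt]] _] := Fc _ (FK n); exists t => //; apply: ltW; apply: h1.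
  by apply: le_ball xt; rewrite ge_min lexx.
have far n : exists2 t, K n t & 9 * r / 10 <= mdist c (phi t).
  have [_ _ [t [Kt yt]]] := Fc _ (FK n); exists t => //.
  have : mdist (phi y) (phi t) < r / 10.
    by apply: h2; apply: le_ball yt; rewrite ge_min lexx orbT.
  by have := metric_triangle c (phi t) (phi y);
    rewrite -/r (metric_sym (phi t)); lra.
have meet (a b : R) : r / 10 <= a -> a < b -> b <= 9 * r / 10 ->
    W [set n | W [set m | exists z, [/\ a <= mdist c z <= b, (phi @` K n) z &
      (phi @` K m) z]]].
  move=> ra ab br; apply: ultra_meet_annulus => // n.
    by have [t Kt ta] := near n; exists t => //; lra.
  by have [t Kt ta] := far n; exists t => //; lra.
(* The images run from within [r / 10] of [c] to beyond [9 * r / 10]. The three ranges of radii are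
   disjoint, so the three meeting points are distinct and their fibres disjoint. *)
have m1 : W [set n | W [set m | exists z, [/\
  r / 10 <= mdist c z <= 2 * r / 10, (phi @` K n) z & (phi @` K m) z]]].
  by apply: meet; lra.
have m2 : W [set n | W [set m | exists z, [/\
  3 * r / 10 <= mdist c z <= 4 * r / 10, (phi @` K n) z & (phi @` K m) z]]].
  by apply: meet; lra.
have m3 : W [set n | W [set m | exists z, [/\
  5 * r / 10 <= mdist c z <= 6 * r / 10, (phi @` K n) z & (phi @` K m) z]]].
  by apply: meet; lra.
have [n [[/= n1 n2] n3]] := filter_ex (filterI (filterI m1 m2) m3).
have [m [[[/= nm [z1 [/andP[_ hz1] An1 Am1]]] [z2 [/andP[hz2 hz2'] An2 Am2]]]
  [z3 [/andP[hz3 _] An3 Am3]]]] :=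
  filter_ex (filterI (filterI (filterI (Wn n.+1) n1) n2) n3).
have nem : n <> m by move=> e'; move: nm; rewrite e' ltnn.
have img (A B : set T) : A `&` B = set0 -> v @` A `&` v @` B = set0.
  move=> AB; apply/seteqP; split=> // p [[s As <-] [t Bt] /iv ts].
  by have : set0 s by rewrite -AB; split=> //; rewrite -ts.
have cim C : continuum C ->
  [/\ v @` C `<=` X, compact (v @` C), closed (v @` C) & connected (v @` C)].
  move=> /(continuum_image cv)[[_ kC] nC]; split=> //;
    first by move=> _ [t _ <-].
  by apply: compact_closed kC; exact: norm_hausdorff.
have fd z z' : z <> z' -> (phi @^-1` [set z]) `&` (phi @^-1` [set z']) = set0.
  by move=> zz; apply/seteqP; split=> // t [/= -> ].
have hit z k : (phi @` K k) z -> v @` (phi @^-1` [set z]) `&` v @` K k !=set0.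
  by move=> [t Kt tz]; exists (v t); split; exists t.
have [s1 k1 c1 l1] := cim _ (fibers z1).
have [s2 k2 c2 l2] := cim _ (fibers z2).
have [s3 k3 c3 l3] := cim _ (fibers z3).
have [sA kA cA lA] := cim _ (cK n).
have [sB kB cB lB] := cim _ (cK m).
apply: (no_theta cX dU sA sB s1 s2 s3 kA k1 k2 cB c2 c3 lA lB l1 l2 l3) => //;
  try (by apply: hit); apply: img; try (by apply: Kd); apply: fd => ez.
- by move: hz1 hz2; rewrite ez; lra.
- by move: hz1 hz3; rewrite ez; lra.
- by move: hz2' hz3; rewrite ez; lra.
Qed.

End collapse.

(** * Quotients of compact metric spaces *)

Section pseudometric.
Local Open Scope quotient_scope.

Lemma metric_quotient (R : realType) (T : choiceType) (D : T -> T -> R) :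
  (forall x, D x x = 0) -> (forall x y, D x y = D y x) ->
  (forall y x z, D x z <= D x y + D y z) ->
  exists (Q : metricType R) (m : T -> Q),
    (forall q, exists x, m x = q) /\ forall x y, mdist (m x) (m y) = D x y.
Proof.
move=> Dxx Dsym Dtri.
have D0 x y : 0 <= D x y.
  by have := Dtri y x x; rewrite Dxx (Dsym y x); lra.
pose r : rel T := fun x y => D x y == 0.
have rr : equiv_class_of r.
  split=> [x|x y|y x z]; rewrite /r.
  - by rewrite Dxx.
  - by rewrite Dsym.
  - move=> /eqP xy /eqP yz; apply/eqP; apply/eqP; rewrite eq_le D0 andbT.
    by have := Dtri y x z; rewrite xy yz; lra.
pose e := EquivRelPack rr.
pose Q := {eq_quot e}.
have rE x y : D x y = 0 -> \pi_Q x = \pi_Q y.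
  by move=> xy; apply/eqmodP; apply/eqP.
have Er x y : \pi_Q x = \pi_Q y -> D x y = 0.
  by move=> /eqmodP/eqP.
pose d (p q : Q) := D (repr p) (repr q).
have dE x y : d (\pi_Q x) (\pi_Q y) = D x y.
  have E z : D z (repr (\pi_Q z)) = 0 by apply: Er; rewrite reprK.
  apply/eqP; rewrite eq_le /d; apply/andP; split.
    have := Dtri x (repr (\pi_Q x)) (repr (\pi_Q y)); have :=
      Dtri y x (repr (\pi_Q y)).
    by rewrite (Dsym (repr _) x) !E; lra.
  have := Dtri (repr (\pi_Q x)) x y; have :=
    Dtri (repr (\pi_Q y)) (repr (\pi_Q x)) y.
  by rewrite (Dsym (repr (\pi_Q y)) y) !E; lra.
have dxx p : d p p = 0 by exact: Dxx.
have dpos p q : d p q = 0 -> p = q by move=> /rE; rewrite !reprK.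
have dsym p q : d p q = d q p by exact: Dsym.
have dtri q p s : d p s <= d p q + d q s by exact: Dtri.
pose M := isMetric.Build R Q dxx dpos dsym dtri.
pose Qm : metricType R := HB.pack Q M.
exists Qm, (\pi_Q : T -> Q); split; first by move=> q; exists (repr q);
  rewrite reprK.
by move=> x y; rewrite -dE.
Qed.

End pseudometric.

Definition closed_equivalence (R : numDomainType) (T : pseudoMetricType R)
    (E : T -> T -> Prop) : Prop :=
  [/\ forall x, E x x, forall x y, E x y -> E y x,
      forall y x z, E x y -> E y z -> E x z &
      forall x y, (forall e : R, 0 < e ->
        exists x' y', [/\ ball x e x', ball y e y' & E x' y']) -> E x y].

(** An alias of [T] to carry the saturated open sets, that is, the quotient topology pulled back to
    [T]. Points are not identified; Urysohn's lemma asks for normality only. *)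
Definition saturated_space (T : Type) : Type := T.
HB.instance Definition _ (T : choiceType) := Choice.on (saturated_space T).

Section quotient.
Variables (R : realType) (T : pseudoMetricType R) (E : T -> T -> Prop).
Hypotheses (cT : compact [set: T]) (hT : hausdorff_space T).
Hypothesis cE : closed_equivalence E.

Lemma unrelated_gap x y : ~ E x y ->
  exists2 e : R, 0 < e & forall x' y', ball x e x' -> ball y e y' -> ~ E x' y'.
Proof.
move=> nxy; apply: contrapT => ne; apply: nxy; have [_ _ _ +] := cE;
  apply=> e e0.
apply: contrapT => nex; apply: ne; exists e => // x' y' xx yy xy; apply: nex.
by exists x', y'.
Qed.

Lemma closed_saturation (F : set T) : closed F ->
  closed [set x | exists2 y, F y & E x y].
Proof.
move=> cF; have /compact_near_coveringP cov : compact F by exact: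
  subclosed_compact cF cT _.
rewrite -[X in closed X]setCK; apply: open_closedC.
rewrite openE => x nx.
have : \forall x' \near x, F `<=` [set y | ~ E x' y].
  apply: cov => y Fy.
  have /unrelated_gap[e e0 h] : ~ E x y by move=> xy; apply: nx; exists y.
  exists (ball y e, ball x e); first by split; exact: nbhsx_ballx.
  by move=> [y' x'] /= [yy xx]; exact: h.
by apply: filterS => x' h [y Fy xy]; exact: (h y Fy).
Qed.

Definition saturated_open (O : set T) := open O /\ forall x y, O x ->
  E x y -> O y.

(** Urysohn's lemma in the topology of saturated open sets. This is normal: disjoint open
    neighbourhoods shrink to their largest saturated subsets, which are open by
    [closed_saturation]. *)
Lemma invariant_urysohn (A B : set T) : closed A -> closed B ->
  A `&` B = set0 ->
  (forall x y, A x -> E x y -> A y) -> (forall x y, B x -> E x y -> B y) ->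
  exists f : T -> R, [/\ continuous f, (forall x, 0 <= f x <= 1),
    (forall x y, E x y -> f x = f y), (forall x, A x -> f x = 0) &
    (forall x, B x -> f x = 1)].
Proof.
move=> cA cB AB sA sB; have [Er Es Et _] := cE.
have oT : saturated_open setT by split=> //; exact: openT.
have oI : setI_closed saturated_open.
  move=> O O' [oO sO] [oO' sO']; split; first exact: openI.
  by move=> x y [Ox O'x] xy; split; [exact: sO xy|exact: sO' xy].
have oU I (f : I -> set T) : (forall i, saturated_open (f i)) ->
  saturated_open (\bigcup_i f i).
  move=> of_; split; first by apply: bigcup_open => i _; case: (of_ i).
  by move=> x y [i _ fx] xy; exists i => //; have [_] := of_ i; apply;
    [exact: fx|].
pose M := isOpenTopological.Build (saturated_space T) oT oI oU.
pose S : topologicalType := HB.pack (saturated_space T) M.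
have openS (O : set S) : open O <-> saturated_open (O : set T) by [].
have closedS (F : set S) : closed F <-> closed (F : set T) /\ forall x y : T,
  (F : set T) x -> E x y -> (F : set T) y.
  split=> [/closed_openC/openS[oF sF]|[cF sF]].
    split; first by rewrite -[F]setCK; exact: open_closedC.
    by move=> x y Fx xy; apply: contrapT => nFy;
      exact: (sF y x nFy (Es _ _ xy)).
  rewrite -[F]setCK; apply: open_closedC; apply/openS; split;
    first exact: closed_openC.
  by move=> x y nFx xy Fy; apply: nFx; exact: sF Fy (Es _ _ xy).
have sat (O : set T) : open O -> saturated_open [set x | forall y, E x y ->
  O y].
  move=> oO; split; last by move=> x y Ox xy z yz; apply: Ox; exact: Et yz.
  rewrite (_ : [set x | _] = ~` [set x | exists2 y, (~` O) y & E x y]).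
    by apply: closed_openC; apply: closed_saturation; exact: open_closedC.
  apply/seteqP; split=> [x Ox [y nOy /Ox//]|x nx y xy].
  by apply: contrapT => nOy; apply: nx; exists y.
have nS : normal_space S.
  apply/(@normal_openP R) => F G /closedS[cF sF] /closedS[cG sG] FG.
  have /(@normal_openP R)/(_ F G cF cG FG)[U [V [oU' oV FU GV UV]]] :=
    compact_normal hT cT.
  exists [set x | forall y, E x y -> U y], [set x | forall y, E x y -> V y];
    split.
  - exact: sat.
  - exact: sat.
  - by move=> x Fx y xy; apply: FU; exact: sF xy.
  - by move=> x Fx y xy; apply: GV; exact: sG xy.
  - apply/seteqP; split=> // x [xU xV].
    by rewrite -UV; split; [exact: xU|exact: xV].
have /(uniform_separatorP (R :=
  R))[f [cf f01 fA fB]] : uniform_separator (A : set S) (B : set S).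
  by move: nS => /(@normal_separatorP R); apply => //; apply/closedS.
exists f; split.
- apply/continuousP => O oO; have /continuousP/(_ O oO) := cf.
  by move=> /openS[].
- by move=> x; have : range f (f x) by [exists x]; move=> /f01;
  rewrite /= in_itv.
(* Level sets are closed in the coarser topology, hence unions of classes. *)
- move=> x y xy; have : closed (f @^-1` [set f x]).
    by apply: (closed_comp (f := f)) => //; exact: closed1.
  by move=> /closedS[_ /(_ x y erefl xy)].
- by move=> x Ax; apply: fA; exists x.
- by move=> x Ax; apply: fB; exists x.
Qed.

End quotient.

Lemma finite_net (R : realType) (T : pseudoMetricType R) (e : R) :
  compact [set: T] -> 0 < e ->
    exists s : seq T, forall x, exists2 p, p \in s & ball p e x.
Proof.
move=> /compact_near_coveringP cov e0.
(* The filter of properties shared by all lists that contain some given list; with it, the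
   near-covering form of compactness yields one list for all points. *)
pose F := [set P : set (seq T) | exists s0 : seq T, forall s : seq T,
  {subset s0 <= s} -> P s].
have FF : Filter F.
  split; first by exists [::].
  - move=> P Q [s hs] [t ht]; exists (s ++ t) => u stu; split.
      by apply: hs => x xs; apply: stu; rewrite mem_cat xs.
    by apply: ht => x xt; apply: stu; rewrite mem_cat xt orbT.
  - by move=> P Q PQ [s hs]; exists s => t /hs; exact: PQ.
have := cov _ F (fun s x => exists2 p, p \in s & ball p e x) FF.
case=> [x _|s hs]; last by exists s => x; exact: hs.
exists (ball x e, [set s : seq T | x \in s]).
  split; first exact: nbhsx_ballx.
  by exists [:: x] => s; apply; rewrite mem_head.
by move=> [y s] /= [xy xs]; exists x.
Qed.

(** As in Urysohn's metrization theorem: countably many invariant functions separate the classes,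
    and a weighted supremum of their differences is a pseudometric that vanishes exactly on [E]. *)
Lemma metrizable_quotient (R : realType) (T : pseudoMetricType R) (E : T ->
  T -> Prop) (t0 : T) :
  compact [set: T] -> hausdorff_space T -> closed_equivalence E ->
  exists (Q : metricType R) (m : T -> Q), [/\ continuous m,
    forall q, exists x, m x = q & forall x y, m x = m y <-> E x y].
Proof.
move=> cT hT cE; have [Er Es Et _] := cE.
pose e n : R := n.+1%:R^-1.
have e0 n : 0 < e n by rewrite invr_gt0.
have [s sP] := choice (fun n => finite_net cT (e0 n)).
pose B n i := ball (nth t0 (s n) i) (e n).
(* An index is a scale and two balls of the net at that scale; pairs of balls that are not apart get
   the zero function. *)
pose apart (k : nat * nat * nat) := forall x y, closure (B k.1.1 k.1.2) x ->
  closure (B k.1.1 k.2) y -> ~ E x y.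
have wit k : exists f : T -> R, [/\ continuous f, (forall x, 0 <= f x <= 1),
    (forall x y, E x y -> f x = f y) &
    apart k -> (forall x, B k.1.1 k.1.2 x ->
      f x = 0) /\ (forall x, B k.1.1 k.2 x -> f x = 1)].
  have [ak|nak] := pselect (apart k); last first.
    exists (fun=> 0); split=> // [|x]; first exact: cst_continuous.
    by rewrite lexx ler01.
  pose S F := [set x | exists2 y, closure F y & E x y].
  have sS F x y : S F x -> E x y -> S F y.
    by move=> [z Fz xz] xy; exists z => //; apply: Et xz; exact: Es.
  have cS F : closed (S F) by apply: closed_saturation => //;
    exact: closed_closure.
  have [|f [f1 f2 f3 f4 f5]] :=
    @invariant_urysohn R T E cT hT cE (S (B k.1.1 k.1.2)) (S (B k.1.1 k.2))
    (cS _) (cS _) _ (@sS _) (@sS _).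
    apply/seteqP; split=> // x [[y By xy] [z Bz xz]].
    by apply: (ak y z By Bz); apply: Et xz; exact: Es.
  exists f; split=> // _; split=> x Bx; [apply: f4|apply: f5]; exists x => //;
    exact: subset_closure.
have {wit} [f fP] := choice wit.
pose F k := f (odflt (0, 0, 0)%N (unpickle k)).
have Fc k : continuous (F k) by have [] := fP (odflt (0, 0, 0)%N (unpickle k)).
have F01 k x : 0 <= F k x <= 1 by have [_ + _ _] :=
  fP (odflt (0, 0, 0)%N (unpickle k)); apply.
have FE k x y : E x y -> F k x = F k y by have [_ _ + _] :=
  fP (odflt (0, 0, 0)%N (unpickle k)); apply.
pose G x y := [set r | exists k, r = `|F k x - F k y| * e k].
pose D x y := sup (G x y).
have F1 k x y : `|F k x - F k y| <= 1.
  by rewrite ler_norml; have /andP[? ?] := F01 k x; have /andP[? ?] :=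
    F01 k y; apply/andP; split; lra.
have e1 k : e k <= 1 by rewrite invf_le1 ?ltr0n // ler1n.
have G1 k x y : `|F k x - F k y| * e k <= e k.
  by rewrite ger_pMl.
have Dge x y k : `|F k x - F k y| * e k <= D x y.
  apply: ub_le_sup; last by exists k.
  by exists 1 => _ [n ->]; exact: le_trans (G1 _ _ _) (e1 n).
have Dle x y c : (forall k, `|F k x - F k y| * e k <= c) -> D x y <= c.
  by move=> h; apply: sup_le_ub; [exists (`|F 0 x - F 0 y| * e 0);
    exists 0%N|move=> _ [k ->]].
have Dxx x : D x x = 0.
  have k0 k : `|F k x - F k x| * e k = 0 by rewrite subrr normr0 mul0r.
  apply/eqP; rewrite eq_le; apply/andP; split; first by apply: Dle => k;
    rewrite k0.
  by apply: le_trans (Dge x x 0%N); rewrite k0.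
have Dsym x y : D x y = D y x.
  by apply/eqP; rewrite eq_le; apply/andP; split; apply: Dle => k;
    rewrite distrC.
have Dtri y x z : D x z <= D x y + D y z.
  apply: Dle => k; apply: le_trans (lerD (Dge x y k) (Dge y z k)).
  by rewrite -mulrDl ler_pM2r //; exact: ler_distD.
have DE x y : D x y = 0 <-> E x y.
  split=> [D0|xy]; last first.
    have k0 k : `|F k x - F k y| * e k = 0 by rewrite (FE k _ _ xy) subrr
      normr0 mul0r.
    apply/eqP; rewrite eq_le; apply/andP; split; first by apply: Dle => k;
      rewrite k0.
    by apply: le_trans (Dge x y 0%N); rewrite k0.
  apply: contrapT => /(unrelated_gap cE)[d d0 gap].
  (* A point of the closed ball is within three radii of any point of the open one, hence the
     third. *)
  have [n /(_ n (leqnn n)) nd] : exists n, forall k, (n <= k)%N -> e k < d / 3.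
    by apply: invS_small; rewrite divr_gt0.
  have [p ps px] := sP n x; have [q qs qy] := sP n y.
  have near z w u : ball z (e n) w -> closure (ball z (e n)) u -> ball w d u.
    move=> zw /(_ _ (nbhsx_ballx u _ (e0 n)))[v [zv uv]].
    by apply: ball_trans (ball_trans (ball_sym zw) zv (lexx _)) (ball_sym uv)
      _; lra.
  pose k := (n, index p (s n), index q (s n)).
  have ak : apart k.
    move=> u w /=; rewrite /B !nth_index // => pu qw.
    by apply: gap; [exact: near pu|exact: near qw].
  have [_ _ _ /(_ ak)[f0 f1]] := fP k.
  have fx : F (pickle k) x = 0 by rewrite /F pickleK /=; apply: f0;
    rewrite /B /= nth_index.
  have fy : F (pickle k) y = 1 by rewrite /F pickleK /=; apply: f1;
    rewrite /B /= nth_index.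
  have := Dge x y (pickle k); rewrite D0 fx fy sub0r normrN normr1 mul1r.
  by rewrite leNgt e0.
have [Q [m [ms mD]]] := metric_quotient Dxx Dsym Dtri.
exists Q, m; split=> // [x|x y]; last first.
  rewrite -DE -mD; split=> [->|]; [exact: mdistxx|exact: mdist_positivity].
apply/cvg_ballP => r r0.
have r2 : 0 < r / 2 by rewrite divr_gt0.
have [n nr] := invS_small r2.
(* From index [n] on the weights alone are below [r / 2]; continuity takes care of the finitely many
   earlier functions. *)
have near_n : \forall y \near x, forall k, (k < n)%N ->
  `|F k x - F k y| < r / 2.
  elim: (n) => [|l IH]; first by apply: nearW.
  have : \forall y \near x, `|F l x - F l y| < r / 2.
    by have /cvgrPdist_lt := Fc l x; exact.
  move=> h; apply: filterS2 IH h => y h1 h2 k.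
  by rewrite ltnS leq_eqVlt => /orP[/eqP->|/h1].
apply: filterS near_n => y h; apply/mdist_ball; rewrite mD.
apply: (@le_lt_trans _ _ (r / 2)); last by lra.
apply: Dle => k; have [/h kr|/nr/ltW] := ltnP k n;
  last exact: le_trans (G1 _ _ _).
by apply: le_trans (ltW kr); rewrite ler_piMr.
Qed.

(** * The finest model *)

Section finest_model.
Variables (R : realType) (T : pseudoMetricType R).
Hypothesis cT : compact [set: T].
Implicit Types (x y : T) (E : T -> T -> Prop).

Definition limit_equiv x y := forall E, closed_equivalence E ->
  (forall u v, limit_related u v -> E u v) -> E x y.

Lemma limit_equiv_closed : closed_equivalence limit_equiv.
Proof.
split=> [x E [Er _ _ _] _|x y xy E|y x z xy yz E|x y xy E].
- exact: Er.
- by move=> cE lE; have [_ Es _ _] := cE; apply: Es; exact: xy.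
- by move=> cE lE; have [_ _ Et _] := cE; apply: (Et y); [exact: xy|exact: yz].
- move=> cE lE; have [_ _ _ Ec] := cE; apply: Ec => e /xy[x' [y' [xx yy x'y']]].
  by exists x', y'; split=> //; exact: x'y'.
Qed.

Lemma limit_equiv_related x y : limit_related x y -> limit_equiv x y.
Proof. by move=> xy E _; apply. Qed.

Definition component_equiv x y := exists D : set T, [/\ connected D, D x, D y &
  forall u v, D u -> D v -> limit_equiv u v].

Lemma component_equiv_ultra_lim (U : set_system nat) (D : nat ->
  set T) : UltraFilter U ->
  (forall n, connected (D n)) ->
  (forall u v, ultra_lim U D u -> ultra_lim U D v -> limit_equiv u v) ->
  forall x y, ultra_lim U D x -> ultra_lim U D y -> component_equiv x y.
Proof.
move=> UU cD DE x y Dx Dy; exists (ultra_lim U D); split=> //.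
apply: connected_ultra_lim => // e e0; apply: filterS filterT => n _.
exact: connected_fine_chained.
Qed.

Lemma inv_lt_free (U : set_system nat) (d : R) : UltraFilter U ->
  (forall n, U [set m | (n <= m)%N]) -> 0 < d -> U [set n | n.+1%:R^-1 < d].
Proof.
by move=> UU Un /invS_small[n hn]; apply: filterS (Un n) => k /hn.
Qed.

(** For the closedness, connected sets that lie in single classes and reach within 1/(n+1) of [x]
    and [y] have a connected limit, which lies in a single class because [limit_equiv] is closed. *)
Lemma component_equiv_closed : closed_equivalence component_equiv.
Proof.
have [Lr Ls Lt Lc] := limit_equiv_closed.
split=> [x|x y [D [cD Dx Dy DE]]|y x z [D [cD Dx Dy DE]] [D' [cD' D'y D'z
  DE']]|x y xy].
- by exists [set x]; split=> //; [exact: connected1|move=> u v -> ->].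
- by exists D.
- exists (D `|` D'); split; [|by left|by right|].
    by apply: connectedU => //; exists y.
  have key u v : D u -> D' v -> limit_equiv u v.
    by move=> Du D'v; apply: (Lt y); [exact: DE|exact: DE'].
  move=> u v [Du|Du] [Dv|Dv]; [exact: DE|exact: key|apply: Ls;
    exact: key|exact: DE'].
- have [U [UU Un]] := free_ultrafilter.
  have wit n : exists D : set T, [/\ connected D,
    D `&` ball x (n.+1%:R^-1 : R) !=set0,
      D `&` ball y (n.+1%:R^-1 : R) !=set0 & forall u v, D u -> D v ->
        limit_equiv u v].
    have [|x' [y' [xx yy [D [cD Dx Dy DE]]]]] := xy (n.+1%:R^-1 : R);
      first by rewrite invr_gt0.
    by exists D; split=> //; [exists x'|exists y'].
  have [D {}wit] := choice wit.
  apply: (component_equiv_ultra_lim UU (D := D)) => [n|u v Du Dv|e e0|e e0].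
  + by have [] := wit n.
  + apply: Lc => e e0.
    have [n [[u' [Du' uu]] [v' [Dv' vv]]]] :=
      filter_ex (filterI (Du e e0) (Dv e e0)).
    by exists u', v'; split=> //; have [_ _ _] := wit n; apply.
  + apply: filterS (inv_lt_free UU Un e0) => n /= /ltW ne;
    have [_ [x' [Dx xx]] _ _] := wit n.
    by exists x'; split=> //; exact: le_ball xx.
  + apply: filterS (inv_lt_free UU Un e0) => n /= /ltW ne;
    have [_ _ [x' [Dx xx]] _] := wit n.
    by exists x'; split=> //; exact: le_ball xx.
Qed.

(** The family of continua changes with [e], so its limit contains only points [x'], [y'] near [x],
    [y]. All points of that limit are limit-related to one another, and [component_equiv] is
    closed. *)
Lemma limit_related_component x y : limit_related x y -> component_equiv x y.
Proof.
move=> xy; have [_ _ _] := component_equiv_closed; apply=> e e0.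
have e2 : 0 < e / 2 by rewrite divr_gt0.
have [F [Finf Fc Fd]] := xy _ e2.
have [K [FK Kd]] := disjoint_sequence Finf Fd.
have [U [UU Un]] := free_ultrafilter.
have wit n : exists p q, [/\ K n p, K n q, ball x (e / 2) p & ball y (e / 2) q].
  by have [_ [p [Kp xp]] [q [Kq yq]]] := Fc _ (FK n); exists p, q.
have [p {}wit] := choice wit; have [q {}wit] := choice wit.
have [x' xx] := ultra_point cT UU p; have [y' yy] := ultra_point cT UU q.
have near z z' (w : nat -> T) : (forall n, ball z (e / 2) (w n)) ->
    (forall e : R, 0 < e -> U [set n | ball z' e (w n)]) -> ball z e z'.
  move=> zw zz; have [n zn] := filter_ex (zz _ e2).
  by apply: ball_trans (zw n) (ball_sym zn) _; lra.
exists x', y'; split.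
- by apply: near xx => n; have [] := wit n.
- by apply: near yy => n; have [] := wit n.
have lim z (w : nat -> T) : (forall n, K n (w n)) ->
    (forall e : R, 0 < e -> U [set n | ball z e (w n)]) -> ultra_lim U K z.
  by move=> Kw zw; apply: ultra_lim_point zw; apply: filterS filterT => n _.
apply: (component_equiv_ultra_lim UU (D := K)) => [n|u v Ku Kv||].
- by have [[]] := Fc _ (FK n).
- apply: limit_equiv_related => d d0.
  have hd : U ([set n | K n `&` ball u d !=set0] `&` [set n | K n `&` ball v d
    !=set0]).
    exact: filterI (Ku d d0) (Kv d d0).
  (* The relation does not involve the second index: [greedy] serves to enumerate a large set
     increasingly. *)
  have [f fP] : exists f : nat -> nat, forall i j, (i < j)%N -> (f i < f j)%N /\
      (K (f i) `&` ball u d !=set0 /\ K (f i) `&` ball v d !=set0).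
    apply: (greedy UU Un (S := fun n _ =>
      K n `&` ball u d !=set0 /\ K n `&` ball v d !=set0)).
        by apply: filterS hd => n hn; apply: filterE.
  have fi : injective f.
    by move=> i j; case: (ltngtP i j) => [/fP[h _] e'|/fP[h _] e'|//];
      move: h; rewrite e' ltnn.
  exists (range (K \o f)); split.
  + apply: infinite_disjoint_sequence => [n|n m nm] /=.
      by have [_ [[z [Kz _]] _]] := fP n n.+1 (ltnSn n); exists z.
    by apply: Kd => /fi.
  + move=> _ [n _ <-] /=; have [cK _ _] := Fc _ (FK (f n)).
    by have [_ [? ?]] := fP n n.+1 (ltnSn n).
  + move=> _ _ [n _ <-] [m _ <-] /= nm; apply: Kd => e'; apply: nm.
    by rewrite e'.
- by apply: lim xx => n; have [] := wit n.
- by apply: lim yy => n; have [] := wit n.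
Qed.

Lemma connected_class x : connected [set y | limit_equiv x y].
Proof.
have cls y : limit_equiv x y -> component_equiv x y.
  by apply; [exact: component_equiv_closed|exact: limit_related_component].
rewrite (_ : [set y | _] = connected_component [set y | limit_equiv x y] x).
  exact: component_connected.
apply/seteqP; split=> y; last exact: connected_component_sub.
move=> /cls[D [cD Dx Dy DE]]; exists D => //; split=> // z Dz; exact: DE.
Qed.

End finest_model.

(** * Quotient maps with connected fibres *)

Section monotone_quotient.
Variables (R : realType) (T : pseudoMetricType R) (Q : metricType R) (m : T ->
  Q).
Hypotheses (cT : compact [set: T]) (cm : continuous m).
Hypothesis ms : forall q, exists x, m x = q.

Lemma closed_map (F : set T) : closed F -> closed (m @` F).
Proof.
move=> cF; apply: compact_closed; first exact: metric_hausdorff.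
apply: continuous_compact; first exact: continuous_subspaceT.
exact: subclosed_compact cF cT _.
Qed.

Lemma compact_quotient : compact [set: Q].
Proof.
rewrite (_ : setT = m @` setT); last first.
  by apply/seteqP; split=> // q _; have [x <-] := ms q; exists x.
by apply: continuous_compact => //; exact: continuous_subspaceT.
Qed.

(** A connected fibre lies in one piece of any separation of the preimage, so the images of the
    pieces are disjoint; they are closed as [m] is a closed map, and would separate [C]. *)
Lemma monotone_quotient (C : set Q) : (forall q, connected (m @^-1` [set q])) ->
  continuum C -> continuum (m @^-1` C).
Proof.
move=> fib [[[q Cq] kC] nC].
have cC : closed C by apply: compact_closed kC; exact: metric_hausdorff.
have cP : closed (m @^-1` C) by apply: closed_comp cC => x _; exact: cm.
split; first split.
- by have [x xq] := ms q; exists x; rewrite /= xq.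
- exact: subclosed_compact cP cT _.
apply/connectedP => E [E0 EU [E01 E10]].
have cE b : closed (E b).
  have sub : closure (E b) `<=` m @^-1` C.
    rewrite [X in _ `<=` X](closure_id _).1; last exact: cP.
    by apply: closureS; rewrite EU; case: b => x; [right|left].
  move=> x xE; have := sub _ xE; rewrite EU; case: b xE {sub} => xE [] Ex //.
    by have : set0 x by rewrite -E10.
  by have : set0 x by rewrite -E01.
have EC b x : E b x -> C (m x).
  by move=> Ex; have : (m @^-1` C) x by rewrite EU; case: b Ex; [right|left].
have same b x y : E b x -> m x = m y -> E b y.
  move=> Ex xy; have sE : separated (E false) (E true) by split.
  have sub : m @^-1` [set m x] `<=` E false `|` E true.
    by rewrite -EU => z /= ->; exact: EC Ex.
  have dis z : E false z -> E true z -> False.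
    by move=> z1 z2; have : set0 z by rewrite -E01; split=> //;
      exact: subset_closure.
  have [h|h] := connected_subset sE sub (fib (m x)); case: b Ex => Ex.
  - by have := dis x (h x erefl) Ex.
  - by apply: h.
  - by apply: h.
  - by have := dis x Ex (h x erefl).
move/connectedP: nC => /(_ (fun b => m @` E b)); apply; split.
- by move=> b; have [x Ex] := E0 b; exists (m x), x.
- apply/seteqP; split=> [p Cp|p [] [x Ex <-]]; [|exact: EC Ex|exact: EC Ex].
  have [x xp] := ms p; have : (m @^-1` C) x by rewrite /= xp.
  by rewrite EU => -[] Ex; [left|right]; exists x.
- have dis p : (m @` E false) p -> (m @` E true) p -> False.
    move=> [x Ex <-] [y Ey yx]; have Ex' := same _ _ _ Ey yx.
    by have : set0 x by rewrite -E01; split=> //; exact: subset_closure.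
  split; apply/seteqP; split=> // p [];
    rewrite -?((closure_id _).1 (closed_map (cE _))).
    exact: dis.
  exact: dis.
Qed.

Lemma suslinian_quotient : (forall q, connected (m @^-1` [set q])) ->
  (forall x y, limit_related x y -> m x = m y) -> finitely_suslinian [set: Q].
Proof.
move=> fib lim e F e0 Fc Fd; apply: contrapT => Finf.
have [K [FK Kd]] := disjoint_sequence Finf Fd.
have [U [UU Un]] := free_ultrafilter.
have e2 : 0 < e / 2 by rewrite divr_gt0.
(* Half of [e], so that the supremum in [diam] need not be attained. *)
have wit n : exists x y, [/\ K n (m x), K n (m y) & e / 2 < mdist (m x) (m y)].
  have [_ [[K0 _] _] ed] := Fc _ (FK n).
  have [|p [q [Kp Kq pq]]] := @diam_lt R Q (K n) (e / 2) K0; first lra.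
  by have [x xp] := ms p; have [y yq] := ms q; exists x, y; rewrite xp yq.
have [x {}wit] := choice wit; have [y {}wit] := choice wit.
have [x0 xx] := ultra_point cT UU x; have [y0 yy] := ultra_point cT UU y.
have e8 : 0 < e / 8 by rewrite divr_gt0.
have e80 : e / 8 + e / 8 < e / 2 by lra.
have : m x0 = m y0.
  apply: lim => d d0.
  have hd : U ([set n | ball x0 d (x n)] `&` [set n | ball y0 d (y n)]).
    exact: filterI (xx d d0) (yy d d0).
  have [f fP] : exists f : nat -> nat, forall i j, (i < j)%N -> (f i < f j)%N /\
      (ball x0 d (x (f i)) /\ ball y0 d (y (f i))).
    apply: (greedy UU Un (S := fun n _ => ball x0 d (x n) /\ ball y0 d (y n))).
        by apply: filterS hd => n hn; apply: filterE.
  have fi : injective f.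
    by move=> i j; case: (ltngtP i j) => [/fP[h _] e'|/fP[h _] e'|//];
      move: h; rewrite e' ltnn.
  have dis n k : n <> k -> m @^-1` K (f n) `&` m @^-1` K (f k) = set0.
    move=> nk; have fnk : f n <> f k by move=> /fi.
    by rewrite -preimage_setI (Kd _ _ fnk) preimage_set0.
  exists (range (fun n => m @^-1` K (f n))); split.
  - apply: infinite_disjoint_sequence => // n.
    by have [h _ _] := wit (f n); exists (x (f n)).
  - move=> _ [n _ <-]; have [h1 h2 _] := wit (f n).
    have [_ [b1 b2]] := fP n n.+1 (ltnSn n); split.
    + by apply: monotone_quotient => //; have [] := Fc _ (FK (f n)).
    + by exists (x (f n)).
    + by exists (y (f n)).
  - move=> _ _ [n _ <-] [k _ <-] nk; apply: dis => e'; apply: nk.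
    by rewrite e'.
have [d1 d10 h1] := continuous_ball x0 cm e8.
have [d2 d20 h2] := continuous_ball y0 cm e8.
have [n [/= /h1 a1 /h2 a2]] := filter_ex (filterI (xx _ d10) (yy _ d20)).
have [_ _ a3] := wit n => e0'.
have := metric_triangle (m (x n)) (m x0) (m (y n)).
by rewrite (metric_sym (m (x n)) (m x0)); rewrite -e0' in a2; lra.
Qed.

(** Any section of [m] defines [g]; it is continuous because [m] is a closed map. *)
Lemma quotient_factor (Z : metricType R) (phi : T -> Z) : continuous phi ->
  (forall x y, m x = m y -> phi x = phi y) ->
  exists2 g : Q -> Z, continuous g & forall x, phi x = g (m x).
Proof.
move=> cphi mphi; have [s sP] := choice ms.
have gm x : phi x = phi (s (m x)) by apply: mphi; rewrite sP.
exists (phi \o s) => //; apply/continuous_closedP => F cF.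
rewrite (_ : _ @^-1` F = m @` (phi @^-1` F)).
  by apply: closed_map; move/continuous_closedP: cphi; apply.
apply/seteqP; split=> [q Fq|_ [x Fx <-]]; last by rewrite /= -gm.
by exists (s q) => //; rewrite sP.
Qed.

End monotone_quotient.

Local Open Scope complex_scope.

(** * From the complex plane to pairs of reals *)

Section coordinates.
Variable R : realType.

(** Pairs of reals have real radii and square balls, which suit the grid; the norm of [R[i]^o] takes
    values in [R[i]]. *)
Definition coord (z : R[i]^o) : R * R := (complex.Re z, complex.Im z).
Definition of_coord (p : R * R) : R[i]^o := p.1 +i* p.2.

Lemma coordK : cancel coord of_coord.
Proof. by case. Qed.

Lemma of_coordK : cancel of_coord coord.
Proof. by case. Qed.

Lemma le_coord_norm (z : R[i]^o) : `|(coord z).1|%:C <= `|z| /\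
  `|(coord z).2|%:C <= `|z|.
Proof.
split; first exact: normc_ge_Re.
rewrite normc_def lecR -sqrtr_sqr ler_wsqrtr // lerDr; exact: sqr_ge0.
Qed.

Lemma norm_le_coord (z : R[i]^o) (M : R) : `|(coord z).1| <= M ->
  `|(coord z).2| <= M ->
  `|z| <= (2 * M)%:C.
Proof.
move=> h1 h2; have M0 : 0 <= M by apply: le_trans h1.
rewrite normc_def lecR -[leRHS]ger0_norm ?mulr_ge0 // -sqrtr_sqr ler_wsqrtr //.
have k (a : R) : `|a| <= M -> a ^+ 2 <= M ^+ 2.
  by move=> h; rewrite -real_normK ?num_real // lerXn2r // nnegrE.
by have := k _ h1; have := k _ h2; rewrite exprMn /=; nra.
Qed.

Lemma coord_continuous : continuous coord.
Proof.
move=> z B /nbhs_ballP[e /= e0 eB]; apply/nbhs_ballP.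
exists (e%:C); first by rewrite /= ltcR.
move=> w; rewrite -ball_normE /= => zw; apply: eB.
have [h1 h2] := le_coord_norm (z - w).
case: z w zw h1 h2 => [a b] [c d] zw h1 h2.
by split; rewrite /ball /= -ltcR;
  [exact: le_lt_trans h1 zw|exact: le_lt_trans h2 zw].
Qed.

Lemma of_coord_continuous : continuous of_coord.
Proof.
move=> p B /nbhs_ballP[e /= e0 eB]; apply/nbhs_ballP.
have [a0 ea] : 0 < complex.Re e /\ e = (complex.Re e)%:C.
  by case: e e0 {eB} => a b; rewrite ltcE /= => /andP[/eqP -> ->].
have a4 : 0 < complex.Re e / 4 by rewrite divr_gt0.
exists (complex.Re e / 4) => // q [/= q1 q2]; apply: eB.
rewrite -ball_normE /= ea;
  apply: le_lt_trans (_ : (2 * (complex.Re e / 4))%:C < _).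
  by apply: norm_le_coord; apply: ltW; [exact: q1|exact: q2].
by rewrite ltcR; lra.
Qed.

End coordinates.

Lemma connected_component_ball (R : realType) (X : set R[i]^o) (p : R * R) (z :
  R[i]^o) r :
  ball p r `<=` (@of_coord R) @^-1` (~` X) -> 
  connected_component (~` X) z (of_coord p) ->
  forall q, ball p r q -> connected_component (~` X) z (of_coord q).
Proof.
move=> pX zp q pq; apply: connected_component_trans zp _.
have [K [cK Kp Kq Kr]] := segment_in_ball pq.
exists (@of_coord R @` K); last by exists q.
split; first by exists p.
  by move=> _ [u /Kr /pX Xu <-].
apply: connected_continuous_connected => //; apply: continuous_subspaceT.
exact: of_coord_continuous.
Qed.

Lemma unshielded_outer_domain (R : realType) (X : set R[i]^o) : compact X ->
  unshielded X ->
  exists U, outer_domain ((@coord R) @` X) U.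
Proof.
move=> kX [U [[z0 Xz0 UE] Uinf] XU].
have cX : closed X by apply: compact_closed kX; exact: norm_hausdorff.
have UX z : U z -> ~ X z by rewrite UE => /connected_component_sub.
exists (@coord R @` U); split.
- rewrite openE => _ [z Uz <-].
  have : nbhs (coord z) (@of_coord R @^-1` (~` X)).
    apply: of_coord_continuous; rewrite coordK; apply: open_nbhs_nbhs; split.
      exact: closed_openC.
    exact: UX.
  move=> /nbhs_ballP[r r0 rX]; apply/nbhs_ballP; exists r => // q zq.
  exists (of_coord q); last exact: of_coordK.
  move: Uz; rewrite UE => Uz; apply: connected_component_ball rX _ _ zq.
  by rewrite coordK.
- apply: connected_continuous_connected; first by rewrite UE;
  exact: component_connected.
  by apply: continuous_subspaceT; exact: coord_continuous.
- move=> M; apply: contrapT => nM; apply: Uinf.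
  have bd z : U z -> `|z| <= (2 * M)%:C.
    move=> Uz; have : ball (0 : R, 0 : R) M (coord z).
      by apply: contrapT => nz; apply: nM; exists (coord z) => //; exists z.
    by case; rewrite /ball /= !sub0r !normrN => h1 h2; apply: norm_le_coord;
      exact: ltW.
  exists (2 * M)%:C; split; first by rewrite complex_real.
  by move=> N MN z Uz /=; apply: le_trans (bd z Uz) (ltW MN).
- apply/seteqP; split=> // p [[z Uz <-] [w Xw /(can_inj (@coordK R)) wz]].
  by apply: (UX z) => //; rewrite -wz.
- move=> _ [z Xz <-] B Bz.
  have : boundary U z by rewrite -XU.
  move=> [/(_ (@coord R @^-1` B)) []]; first exact: coord_continuous.
  by move=> w [Uw Bw] _; exists (coord w); split=> //; exists w.
Qed.

Lemma compact_set_type (R : realType) (P : pseudoMetricType R) (X : set P) :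
  compact X -> compact [set: X].
Proof.
move=> kX F PF _.
have FX : F ((set_val : X -> P) @^-1` X).
  by apply: filterS filterT => y _; exact: set_valP.
have [x [Xx xc]] := kX (set_val @ F) _ FX.
exists (exist _ x (mem_set Xx)); split=> // A B FA /nbhs_ballP[r r0 rB].
have FA' : F ((set_val : X -> P) @^-1` (set_val @` A)).
  by apply: filterS FA => a Aa; exists a.
have [_ [[a Aa <-] xa]] := xc _ _ FA' (nbhsx_ballx x r r0).
by exists a; split=> //; apply: rB; rewrite -initial_ballE.
Qed.

Lemma set_val_continuous (R : realType) (P : pseudoMetricType R) (X : set P) :
  continuous (set_val : X -> P).
Proof. exact: initial_continuous. Qed.

Lemma hausdorff_set_type (R : realType) (P : pseudoMetricType R) (X : set P) :
  hausdorff_space P -> hausdorff_space X.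
Proof.
move=> hP p q pq; apply: val_inj; apply: hP => A B.
move=> /(@set_val_continuous _ _ X) Ap /(@set_val_continuous _ _ X) Bq.
by have [t [At Bt]] := pq _ _ Ap Bq; exists (set_val t).
Qed.

(** * Transfer along an embedding onto a subset *)

Section embedding.
Variables (S T : topologicalType) (X : set S) (j : T -> S).
Hypotheses (cj : continuous j) (ij : injective j) (jX : range j = X).
Hypotheses (cT : compact [set: T]) (hS : hausdorff_space S).

Lemma within_continuous_embedding (Y : topologicalType) (f : S -> Y) :
  continuous (f \o j) -> {within X, continuous f}.
Proof.
move=> cf; apply/continuous_closedP => F cF; apply/closed_subspaceP.
exists (j @` ((f \o j) @^-1` F)).
  apply: compact_closed => //; apply: continuous_compact;
    first exact: continuous_subspaceT.
  by apply: (subclosed_compact _ cT) => //; apply: closed_comp cF => x _;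
    exact: cf.
apply/seteqP; split=> x [].
  by move=> [t Ft <-] Xx; split.
by move=> Fx /[dup] Xx; rewrite -{1}jX => -[t _ tx]; split=> //; exists t;
  rewrite //= tx.
Qed.

Lemma continuous_embedding (Y : topologicalType) (f : S -> Y) :
  {within X, continuous f} -> continuous (f \o j).
Proof.
move=> /continuousP cf; apply/continuousP => O /cf/open_subspaceP[V oV VX].
have -> : (f \o j) @^-1` O = j @^-1` V.
  have jt t : X (j t) by rewrite -jX; exists t.
  apply/seteqP; split=> t /= h.
    by have : (f @^-1` O `&` X) (j t) by []; rewrite -VX => -[].
  by have : (V `&` X) (j t) by []; rewrite VX => -[].
by move: cj => /continuousP; exact.
Qed.

Lemma image_preimage_embedding (Y : Type) (f : S -> Y) (C : set Y) :
  X `&` f @^-1` C = j @` ((f \o j) @^-1` C).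
Proof.
apply/seteqP; split=> [x []|_ [t Ct <-]].
  by rewrite -{1}jX => -[t _ <-] Ct; exists t.
by split=> //; rewrite -jX; exists t.
Qed.

(** By compactness the inverse of [j] is continuous on [X]; [i] extends it by an arbitrary value. *)
Lemma continuum_embedding (C : set T) : continuum (j @` C) -> continuum C.
Proof.
move=> [[[_ [t Ct _]] kC] nC].
pose i (x : S) := if pselect (exists t,
  j t = x) is left h then projT1 (cid h) else t.
have iK s : i (j s) = s.
  rewrite /i; case: pselect => [h|nh]; last by exfalso; apply: nh; exists s.
  by apply: ij; case: cid.
have ci : {within X, continuous i}.
  apply: within_continuous_embedding; have ->
    : i \o j = id by apply/funext => u; exact: iK.
  by move=> u; exact: cvg_id.
have sub : j @` C `<=` X by move=> _ [s _ <-]; rewrite -jX; exists s.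
have CE : C = i @` (j @` C).
  apply/seteqP; split=> [s Cs|_ [_ [s Cs <-] <-]]; last by rewrite iK.
  by exists (j s); [exists s|rewrite iK].
have ci' : {within j @` C, continuous i} by exact: continuous_subspaceW sub ci.
split; first split; first by exists t.
  by rewrite CE; exact: continuous_compact.
by rewrite CE; exact: connected_continuous_connected.
Qed.

End embedding.

Theorem theorem4 (R : realType) (X : set R[i]^o)
  (X_compactum : compactum X) (X_unshielded : unshielded X) :
  exists (X_FS : metricType R) (m : R[i]^o -> X_FS),
    [/\ compactum [set: X_FS],
        finitely_suslinian [set: X_FS],
        monotone_map_onto X [set: X_FS] m &
        forall (Z : metricType R) (phi : R[i]^o -> Z),
          compactum [set: Z] -> finitely_suslinian [set: Z] ->
          monotone_map_onto X [set: Z] phi ->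
          exists2 g : X_FS -> Z, continuous g &
            forall x, X x -> phi x = g (m x)].
Proof.
have [[x0 Xx0] kX] := X_compactum.
have [U dU] := unshielded_outer_domain kX X_unshielded.
pose P := (@coord R) @` X; pose T : pseudoMetricType R := P.
have kP : compact P.
  by apply: continuous_compact => //; apply: continuous_subspaceT;
    exact: coord_continuous.
have cT : compact [set: T] by exact: compact_set_type.
have hT : hausdorff_space T by apply: hausdorff_set_type; exact: norm_hausdorff.
pose v : T -> R * R := set_val.
have cv : continuous v by exact: set_val_continuous.
have iv : injective v by exact: val_inj.
have vP t : P (v t) by exact: set_valP.
pose j : T -> R[i]^o := @of_coord R \o v.
have cj : continuous j.
  by move=> t; apply: continuous_comp; [exact: cv|exact: of_coord_continuous].
have ij : injective j by move=> s t /(can_inj (@of_coordK R)) /iv.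
have hC : hausdorff_space R[i]^o by exact: norm_hausdorff.
have jX : range j = X.
  apply/seteqP; split=> [_ [t _ <-]|x Xx].
    by have [x Xx xt] := vP t; rewrite /j /= -xt coordK.
  have Px : P (coord x) by exists x.
  by exists (exist (fun p => p \in P) _ (mem_set Px)) => //;
    rewrite /j /= coordK.
have [t0 _ jt0] : range j x0 by rewrite jX.
have cE := limit_equiv_closed T.
have [Q [mT [cm ms mE]]] := metrizable_quotient t0 cT hT cE.
have fib q : connected (mT @^-1` [set q]).
  have [x <-] := ms q.
  rewrite (_ : _ @^-1` _ = [set y | limit_equiv x y]);
    first exact: connected_class.
  have [_ Es _ _] := cE.
  by apply/seteqP; split=> y /=; [move=> /esym/mE|move=> /mE].
(* Off [X] the value is arbitrary, since a map onto the model is judged by its restriction to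
   [X]. *)
pose m (z : R[i]^o) : Q :=
  if pselect (exists t, j t = z) is left h then mT (projT1 (cid h)) else mT t0.
have mj : m \o j = mT.
  apply/funext => t; rewrite /m /=; case: pselect => [h|nh]; last by exfalso;
    apply: nh; exists t.
  by congr mT; apply: ij; case: cid.
exists Q, m; split.
- by split; [exists (mT t0)|exact: compact_quotient cm ms].
- apply: (suslinian_quotient cT cm ms fib) => x y xy.
  by apply/mE; exact: limit_equiv_related.
- split.
  + by apply: (within_continuous_embedding cj jX cT hC); rewrite mj.
  + apply/seteqP; split=> // q _; have [t <-] := ms q.
    by exists (j t); [rewrite -jX; exists t|rewrite -mj].
  + move=> C _ cC; rewrite (image_preimage_embedding jX) mj.
    by apply: (continuum_image cj); exact: monotone_quotient cC.
- move=> Z phi [_ kZ] fsZ [cphi phiX phim].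
  have cphij : continuous (phi \o j) by exact: continuous_embedding cj jX _ _
    cphi.
  have fibers z : continuum ((phi \o j) @^-1` [set z]).
    apply: (continuum_embedding cj ij jX cT hC);
      rewrite -(image_preimage_embedding jX).
    apply: phim => //; split; last exact: connected1.
    by split; [exists z|exact: compact_set1].
  have col := limit_related_collapse kP dU cv iv vP cphij kZ fsZ fibers.
  (* The kernel of [phi] competes in the definition of [limit_equiv], so by minimality [phi] is
     constant on its classes. *)
  have kerE : closed_equivalence (fun x y => phi (j x) = phi (j y)).
    split=> [//|x y ->//|y x z -> //|x y near].
    apply/eqP; apply: contrapT => /negP; rewrite -mdist_gt0 => d0.
    have d3 : 0 < mdist (phi (j x)) (phi (j y)) / 3 by rewrite divr_gt0.
    have [e1 e10 h1] := continuous_ball x cphij d3.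
    have [e2 e20 h2] := continuous_ball y cphij d3.
    have [|x' [y' [xx yy xy']]] := near (Num.min e1 e2);
      first by rewrite lt_min e10.
    have := h1 x' (le_ball _ xx); rewrite ge_min lexx => /(_ isT).
    have := h2 y' (le_ball _ yy); rewrite ge_min lexx orbT => /(_ isT) /=.
    rewrite xy'; have := metric_triangle (phi (j x)) (phi (j y')) (phi (j y)).
    by rewrite (metric_sym (phi (j y')) (phi (j y))); lra.
  have [g cg gE] : exists2 g : Q ->
    Z, continuous g & forall x, (phi \o j) x = g (mT x).
    apply: (quotient_factor cT cm ms cphij) => x y /mE xy.
    by apply: (xy _ kerE) => u w; exact: col.
  exists g => // x; rewrite -jX => -[t _ <-].
  by rewrite -[m (j t)]/((m \o j) t) mj -gE.
Qed.
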